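(* Let $d\ge2$ and let $Z,Z_1,Z_2,\ldots$ be i.i.d. random vectors in $\mathbb{R}^d$ with $\mathbb{E}\|Z\|<\infty$ and $\mu:=\mathbb{E}Z\neq\mathbf{0}$. Let $S_0=\mathbf{0}$, $S_n=\sum_{i=1}^nZ_i$, $\mathcal{H}_n=\operatorname{hull}\{S_0,\ldots,S_n\}$. Let $F:(\mathfrak{C}_d^0,\rho_H)\to([0,\infty),\rho_E)$ be macroscopic, and suppose that $\lim_{n\to\infty}F(\mathcal{H}_n)=+\infty$ a.s. Then for every sequence $b_n\in(0,\infty)$, the random variable $\limsup_{n\to\infty}F(\mathcal{H}_n)/b_n$ is almost surely equal to a constant in $[0,+\infty]$.
   Context: $\mathfrak{C}_d^0$ is the set of compact convex subsets of $\mathbb{R}^d$ containing $\mathbf{0}$, with Hausdorff metric $\rho_H$; $\rho_E$ is the Euclidean metric. $\mathcal{B}_d(\mathbf{0},r)$ is the closed Euclidean ball of radius $r$ about $\mathbf 0$, and $A\triangle B$ is the symmetric difference. $F:\mathfrak{C}_d^0\to[0,\infty)$ is macroscopic if for every $\varepsilon\in(0,1)$ and $r\ge0$ there exists $v\ge0$ such that $|F(C_1)/F(C_2)-1|\le\varepsilon$ for all $C_1,C_2\in\mathfrak{C}_d^0$ with $C_1\triangle C_2\subseteq\mathcal{B}_d(\mathbf{0},r)$ and $F(C_1)\ge v$. *)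

(* Defs.v *)
From HB Require Import structures.
From mathcomp Require Import all_boot all_order all_algebra.
From mathcomp Require Import all_classical all_reals all_analysis.
Set Implicit Arguments. Unset Strict Implicit. Unset Printing Implicit Defensive.
Import Order.TTheory GRing.Theory Num.Theory.
Import numFieldNormedType.Exports.
Local Open Scope classical_set_scope.
Local Open Scope ring_scope.

Section Defs.
Variables (R : realType) (d : nat).
Local Notation vec := 'rV[R]_d.

(* Euclidean norm on R^d (rows); note the library norm on 'rV is the max norm. *)
Definition enorm (v : vec) : R := Num.sqrt (\sum_(i < d) v 0 i ^+ 2).

Definition eball (x : vec) (r : R) : set vec := [set y | enorm (y - x) <= r].

Definition convex_set (C : set vec) : Prop :=
  forall x y t, C x -> C y -> 0 <= t <= 1 -> C (t *: x + (1 - t) *: y).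

Definition C0d : set (set vec) :=
  [set C | compact C /\ convex_set C /\ C 0].

Definition rhoH (A B : set vec) : R :=
  inf [set r : R | 0 <= r /\
        (forall a, A a -> exists2 b, B b & enorm (a - b) <= r) /\
        (forall b, B b -> exists2 a, A a & enorm (a - b) <= r)].

Definition symdiff (A B : set vec) : set vec := (A `\` B) `|` (B `\` A).

Definition hausdorff_borel2 : set (set (set vec)) :=
  <<s C0d, [set S | exists D r, C0d D /\ S = [set C | C0d C /\ rhoH D C < r]] >>.

Definition functional_on_C0d (F : set vec -> R) : Prop :=
  (forall C, C0d C -> 0 <= F C) /\
  (forall t : R, hausdorff_borel2 [set C | C0d C /\ F C <= t]).

Definition macroscopic (F : set vec -> R) : Prop :=
  forall eps : R, 0 < eps < 1 -> forall r : R, 0 <= r ->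
  exists v : R, 0 <= v /\
    forall C1 C2, C0d C1 -> C0d C2 -> symdiff C1 C2 `<=` eball 0 r ->
      v <= F C1 -> `|F C1 / F C2 - 1| <= eps.

Definition borel_vec : set (set vec) := <<s [set: vec], [set U | open U] >>.

Definition hull_pts (n : nat) (p : nat -> vec) : set vec :=
  [set x | exists lam : 'I_n.+1 -> R, (forall k, 0 <= lam k) /\
     \sum_(k < n.+1) lam k = 1 /\ x = \sum_(k < n.+1) lam k *: p k].

End Defs.

Section Prob.
Variables (R : realType) (dsp : measure_display) (T : measurableType dsp)
  (P : probability T R) (d : nat).

Definition random_vector (X : T -> 'rV[R]_d) : Prop :=
  forall B, borel_vec B -> measurable (X @^-1` B).

Definition mutually_independent (X : nat -> T -> 'rV[R]_d) : Prop :=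
  forall (s : seq nat) (B : nat -> set 'rV[R]_d), uniq s ->
    (forall i, borel_vec (B i)) ->
    P (\bigcap_(i in [set j | j \in s]) (X i @^-1` B i)) =
      (\prod_(i <- s) P (X i @^-1` B i))%E.

Definition identically_distributed (X : nat -> T -> 'rV[R]_d) : Prop :=
  forall n B, borel_vec B -> P (X n @^-1` B) = P (X 0 @^-1` B).

Definition mean_vec (X : T -> 'rV[R]_d) : 'rV[R]_d :=
  \row_i fine (\int[P]_w (X w 0 i)%:E).
End Prob.

(* Main.v *)
Require Import Defs.
From HB Require Import structures.
From mathcomp Require Import all_boot all_order all_algebra.
From mathcomp Require Import all_classical all_reals all_analysis.
From mathcomp Require Import measurable_realfun ring lra zify.
Set Implicit Arguments. Unset Strict Implicit. Unset Printing Implicit Defensive.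
Import Order.TTheory GRing.Theory Num.Theory.
Import numFieldNormedType.Exports.
Local Open Scope classical_set_scope.
Local Open Scope ring_scope.

(** By the Hewitt-Savage zero-one law it suffices that the upper limit is a.s.
    unchanged by finitary permutations of the steps. Such a permutation alters
    only finitely many vertices of the hulls; since [F] is macroscopic, it is
    enough that the symmetric difference of the two hulls stays in a fixed ball.
    A point [z] of their difference is strictly separated by a direction [u],
    in which the hull containing [z] is maximal at an altered vertex.
    The walk is unbounded above in every relevant direction [v] with
    [v . mu >= 0], so by compactness [u . mu < - delta] for a fixed [delta].
    As the walk stays close to the ray of [mu] by the law of large numbers,
    [u . z > 0] then bounds [z].

    The strong law is obtained from a maximal inequality and the zero-one law.
    Unboundedness in a fixed driftless direction follows since a bounded
    driftless walk would have an a.s. constant supremum; all such directions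
    are handled at once because the cone of directions of boundedness is, up to
    closure, deterministic. *)

(** * The canonical space of sequences *)

(** Permutations must act on samples, so the argument runs on sequence space under the law of the
    steps and is pulled back to the original space at the end. There [reidx] along an injection
    covers both permutations and shifts of the steps, and an i.i.d. law is invariant under it.

    The main obstacle is that the separating direction depends on the sample and on the point
    separated: exceptional null sets of single directions cannot be united over uncountably many of
    them, and even boundedness in some direction of a given set needs compactness to be an event.

    A second obstacle is degeneracy: in a direction orthogonal to almost every step the walk never
    moves. Separating directions are therefore projected to the orthogonal complement of these null
    directions, which changes no inner product with the paths. *)

Definition cylinders (R : realType) (d : nat) : set (set (nat -> 'rV[R]_d)) :=
  [set C | exists i B, borel_vec B /\ C = [set x | B (x i)]].

Notation seqT R d := (g_sigma_algebraType (@cylinders R d)).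

Definition iid (R : realType) (d : nat) (Q : probability (seqT R d) R) :=
  mutually_independent Q (fun i (x : seqT R d) => x i) /\
  identically_distributed Q (fun i (x : seqT R d) => x i).

Section Canonical.
Context {R : realType} {d : nat}.
Local Notation vec := 'rV[R]_d.
Local Notation X := (seqT R d).

Definition reidx (s : nat -> nat) (x : X) : X := fun i => x (s i).

Lemma measurable_coord i (B : set vec) : borel_vec B ->
  measurable [set x : X | B (x i)].
Proof. by move=> mB; apply: sub_sigma_algebra; exists i, B. Qed.

Lemma measurable_into_seqT dsp (T : measurableType dsp) (f : T -> X) :
  (forall i, random_vector (fun w => f w i)) -> measurable_fun setT f.
Proof.
move=> mf; apply: (@measurability _ _ T X setT f (@cylinders R d)) => //.
by move=> _ [_ [i [B [mB ->]]] <-]; rewrite setTI; exact: mf.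
Qed.

Lemma measurable_reidx s : measurable_fun setT (reidx s).
Proof. by apply: measurable_into_seqT => i B; exact: measurable_coord. Qed.

Lemma measurable_reidx_preimage s (A : set X) :
  measurable A -> measurable (reidx s @^-1` A).
Proof. by move=> mA; rewrite -[_ @^-1` _]setTI; exact: measurable_reidx. Qed.

(** Constraining a whole initial segment of coordinates makes this generating family stable under
    intersection, as uniqueness of measures requires; single-coordinate cylinders are not stable in
    general. *)
Definition rectangles : set (set X) :=
  [set A | exists n (B : nat -> set vec), (forall i, borel_vec (B i)) /\
     A = [set x | forall i, (i < n)%N -> B i (x i)]].

Lemma borel_vecT : borel_vec [set: vec].
Proof. by apply: sub_sigma_algebra; exact: openT. Qed.

Lemma borel_vecI (A B : set vec) : borel_vec A -> borel_vec B ->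
  borel_vec (A `&` B).
Proof.
move=> mA mB.
exact: (@measurableI _ (g_sigma_algebraType [set U : set vec | open U])).
Qed.

Lemma rectangles_setI : setI_closed rectangles.
Proof.
move=> _ _ [n [B [mB ->]]] [m [C [mC ->]]].
exists (maxn n m), (fun i => (if (i < n)%N then B i else setT) `&`
                             (if (i < m)%N then C i else setT)); split.
  by move=> i; apply: borel_vecI; case: ifP => _ //; exact: borel_vecT.
apply/seteqP; split => x /=.
  by move=> [Bx Cx] i _; split; case: ifP => // /[dup]; [move=> ? /Bx|move=> ? /Cx].
move=> BC; split=> i lti.
  by have := BC i; rewrite leq_max lti => /(_ isT) [].
by have := BC i; rewrite leq_max lti orbT => /(_ isT) [_].
Qed.

Lemma rectangle_setT : rectangles setT.
Proof.
exists 0%N, (fun=> setT); split; first by move=> _; exact: borel_vecT.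
by apply/seteqP; split.
Qed.

Lemma rectangle_cylinder i B : borel_vec B -> rectangles [set x : X | B (x i)].
Proof.
move=> mB; exists i.+1, (fun j => if j == i then B else setT); split.
  by move=> j; case: ifP => // _; exact: borel_vecT.
apply/seteqP; split=> x /=; last by move=> /(_ i (ltnSn i)); rewrite eqxx.
by move=> Bx j _; case: ifP => // /eqP ->.
Qed.

Lemma measurable_rectangle A : rectangles A -> measurable A.
Proof.
move=> [n [B [mB ->]]].
rewrite (_ : [set _ | _] =
    \bigcap_i [set x : X | (if (i < n)%N then B i else setT) (x i)]).
  apply: bigcapT_measurable => i; apply: measurable_coord.
  by case: ifP => // _; exact: borel_vecT.
apply/seteqP; split=> x /= Bx i => [_|lti]; first by case: ifP => // /Bx.
by have := Bx i I; rewrite lti.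
Qed.

Lemma measurable_seqTE : @measurable _ X = <<s rectangles >>.
Proof.
apply/seteqP; split.
  apply: smallest_sub; first exact: smallest_sigma_algebra.
  move=> _ [i [B [mB ->]]]; apply: sub_sigma_algebra.
  exact: rectangle_cylinder.
apply: smallest_sub; first exact: sigma_algebra_measurable.
exact: measurable_rectangle.
Qed.

End Canonical.

(** * Invariance of an i.i.d. law under injective reindexing *)

Section IID.
Context {R : realType} {d : nat}.
Local Notation vec := 'rV[R]_d.
Local Notation X := (seqT R d).
Variable Q : probability X R.
Hypothesis iidQ : iid Q.

Lemma iid_rect (s : nat -> nat) n (B : nat -> set vec) :
  {in gtn n &, injective s} ->
  (forall i, borel_vec (B i)) ->
  Q [set x | forall i, (i < n)%N -> B i (x (s i))] =
  (\prod_(i < n) Q [set x | B i (x 0%N)])%E.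
Proof.
move=> injs mB; have [indep idd] := iidQ.
pose l := map s (iota 0 n).
(* Independence is stated by the coordinates read, so each [B i] is moved to the coordinate [s i];
   [index] inverts [s] on the list [l]. *)
pose C j := B (index j l).
have ixs i : (i < n)%N -> index (s i) l = i.
  move=> lti; rewrite /l -[i in s i](nth_iota 0 0 lti).
  rewrite -(nth_map _ (s 0)) ?size_iota// index_uniq ?size_map ?size_iota//.
  by rewrite map_inj_in_uniq ?iota_uniq// => j k; rewrite !mem_iota !add0n; exact: injs.
have := indep l C _ (fun=> mB _).
rewrite map_inj_in_uniq ?iota_uniq; last first.
  by move=> j k; rewrite !mem_iota !add0n; exact: injs.
move=> /(_ isT) e.
rewrite [LHS](_ : _ = Q (\bigcap_(i in [set j | j \in l]) [set x : X | C i (x i)])).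
  rewrite e big_map (_ : iota 0 n = index_iota 0 n); last first.
    by rewrite /index_iota subn0.
  rewrite big_mkord; apply: eq_bigr => i _.
  by rewrite -(idd (s i) (B i))// /C ixs.
congr (Q _); apply/seteqP; split=> x /=.
  move=> Bx j /= /mapP[i]; rewrite mem_iota add0n => /andP[_ lti] ->.
  by rewrite /C ixs//; exact: Bx.
move=> h i lti; have := h (s i); rewrite /= /C ixs//; apply.
by apply: map_f; rewrite mem_iota.
Qed.

(** By [iid_rect] the probability of a rectangle read along [s] does not depend on the injection
    [s], and rectangles determine the measure. *)
Lemma reidx_law (s : nat -> nat) (A : set X) : injective s -> measurable A ->
  Q (reidx s @^-1` A) = Q A.
Proof.
move=> injs mA.
have mA' : <<s rectangles >> A by rewrite -measurable_seqTE.
rewrite -[LHS]/(pushforward Q (reidx s) A).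
apply: (@g_sigma_algebra_measure_unique _ _ _ rectangles _ (fun=> setT)
  _ _ (pushforward Q (reidx s))) => //.
- exact: measurable_rectangle.
- by move=> _; exact: rectangle_setT.
- by rewrite bigcup_const.
- exact: measurable_reidx.
- exact: rectangles_setI.
- move=> ? _ [n [B [mB ->]]].
  transitivity (\prod_(i < n) Q [set x | B i (x 0%N)])%E.
    by apply: iid_rect => // i j _ _; exact: injs.
  by rewrite -(iid_rect (s := id)).
- by move=> ? _; rewrite [X in (X < _)%E](_ : _ = Q setT)// probability_setT ltry.
Qed.

End IID.

Lemma measurable_superlevel (R : realType) (dsp : measure_display)
  (T : measurableType dsp) (f : T -> R) (q : R) :
  measurable_fun setT f -> measurable [set x | q < f x].
Proof.
move=> mf; have := mf measurableT `]q, +oo[%classic (measurable_itv _).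
rewrite setTI; congr (measurable _); apply/seteqP.
by split=> x /=; rewrite in_itv/= andbT.
Qed.

(** * Decoupling by second moments *)

Section Prob0.
Context {R : realType} {dsp : measure_display} {T : measurableType dsp}.
Variable Q : probability T R.

Lemma fine_probE A : measurable A -> Q A = (fine (Q A))%:E.
Proof. by move=> mA; rewrite fineK// fin_num_measure. Qed.

(** The double sum is the expectation of the square of [\sum_i c i * \1_(C i)]. *)
Lemma gram_ge0 (I : finType) (C : I -> set T) (c : I -> R) :
  (forall i, measurable (C i)) ->
  0 <= \sum_i \sum_j c i * c j * fine (Q (C i `&` C j)).
Proof.
move=> mC.
have intf (p : I * I) : Q.-integrable setT
    (fun x => (c p.1 * c p.2)%:E * (\1_(C p.1 `&` C p.2) x)%:E)%E.
  by apply: integrableZl => //; apply: integrable_indic; exact: measurableI.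
have : (0 <= \int[Q]_x \sum_p (c p.1 * c p.2)%:E * (\1_(C p.1 `&` C p.2) x)%:E)%E.
  apply: integral_ge0 => x _.
  rewrite [leRHS](_ : _ = ((\sum_i c i * \1_(C i) x) ^+ 2)%:E) ?lee_fin ?sqr_ge0//.
  under eq_bigr do rewrite -EFinM.
  rewrite sumEFin; congr EFin; rewrite expr2 big_distrlr/= pair_bigA/=.
  by apply: eq_bigr => -[i j] _ /=; rewrite indicI/=; ring.
rewrite integral_sum//.
under eq_bigr => p _.
  rewrite integralZl//; last by apply: integrable_indic; exact: measurableI.
  rewrite integral_indic//; last exact: measurableI.
  rewrite setIT -[X in (_ * X)%E]fineK; last exact/fin_num_measure/measurableI.
  rewrite -EFinM.
  over.
by rewrite sumEFin lee_fin pair_bigA/=.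
Qed.

(* The second moment of [\sum_(m < M) (1_(B m) - p) - M e 1_A] would be
   negative for large [M] if [e = q - a p] were nonzero. *)
Lemma asymptotic_decoupling (A : set T) (B : nat -> set T) (a p q : R) :
  measurable A -> (forall m, measurable (B m)) ->
  Q A = a%:E -> (forall m, Q (B m) = p%:E) ->
  (forall m l, m != l -> Q (B m `&` B l) = (p * p)%:E) ->
  (forall m, Q (A `&` B m) = q%:E) -> q = a * p.
Proof.
move=> mA mB QA QB QBB QAB.
have a1 : a <= 1 by rewrite -lee_fin -QA probability_le1.
have p0 : 0 <= p by rewrite -lee_fin -(QB 0%N) measure_ge0.
have p1 : p <= 1 by rewrite -lee_fin -(QB 0%N) probability_le1.
pose e := q - a * p.
suff H M : M%:R * e ^+ 2 <= 1.
  suff e0 : e = 0 by apply/eqP; rewrite -subr_eq0 -/e e0.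
  apply/eqP; apply: contraT => e0.
  have e2 : 0 < e ^+ 2 by rewrite exprn_even_gt0.
  have := H (Num.truncn (e ^+ 2)^-1).+1.
  rewrite -ler_pdivlMr// div1r => h.
  by have := truncnS_gt (e ^+ 2)^-1; rewrite ltNge h.
have sc (x : R) : \sum_(i < M) x = M%:R * x.
  by rewrite sumr_const card_ord mulr_natl.
(* Index 0 carries [A], index 1 the sure event, whose coefficient does the centring, and index
   [m + 2] the event [B m]. *)
pose C (i : 'I_M.+2) := if i is Ordinal (S (S m)) _ then B m
  else if i is Ordinal 0 _ then A else setT.
pose c (i : 'I_M.+2) := if i is Ordinal (S (S m)) _ then 1
  else if i is Ordinal 0 _ then - (M%:R * e) else - (M%:R * p).
have mC i : measurable (C i).
  by case: i => -[|[|m]] mM; rewrite /C.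
have := gram_ge0 c mC.
rewrite !big_ord_recl/=.
rewrite !setIT !setTI !setIid probability_setT QA/=.
under eq_bigr do rewrite QAB/=.
under [X in _ + (_ + (_ + X) + _)]eq_bigr do rewrite setTI QB/=.
under [X in _ + (_ + X)]eq_bigr => m _.
  rewrite !big_ord_recl/= setIC QAB setIT QB/=.
  under eq_bigr => l _.
    rewrite (_ : fine _ = p * p + (if l == m then p - p * p else 0)); last first.
      case: eqP => [->|/eqP lm]; first by rewrite setIid QB/=; ring.
      by rewrite QBB ?addr0// eq_sym.
    rewrite !mul1r.
    over.
  rewrite big_split/= sc -big_mkcond/= big_pred1_eq.
  over.
rewrite !sc -/e => H.
have [->|M0] := eqVneq M 0%N; first by rewrite mul0r.
have M1 : 0 < M%:R :> R by rewrite ltr0n lt0n.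
(* The three contributions are the variance [M (p - p^2)], the cross term [- 2 M^2 e^2] and the
   square [M^2 e^2 a]; the second outweighs the third because [a <= 1]. *)
have {}H : 0 <= M%:R * (p - p * p - M%:R * e ^+ 2 * (2 - a)).
  apply: le_trans H _; rewrite le_eqVlt; apply/orP; left; apply/eqP.
  have -> : q = e + a * p by rewrite /e; ring.
  by ring.
have e2 : 0 <= M%:R * e ^+ 2 by rewrite mulr_ge0 ?sqr_ge0// ltW.
rewrite pmulr_rge0// in H.
have k1 : 0 <= M%:R * e ^+ 2 * (1 - a) by rewrite mulr_ge0// subr_ge0.
have pp : 0 <= p * p by exact: mulr_ge0.
move: (M%:R * e ^+ 2) H k1 {e2} => k H k1.
lra.
Qed.
End Prob0.

(** * The Hewitt-Savage zero-one law *)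

Section AE.
Context {R : realType} {dsp : measure_display} {T : measurableType dsp}.
Variable Q : probability T R.

Lemma ae_inhabited (P : T -> Prop) : {ae Q, forall x, P x} -> exists x, P x.
Proof.
move=> aeP; apply: contrapT => /forallNP nP.
have [N [mN N0 sN]] := aeP.
have NT : N = setT by apply/seteqP; split=> // x _; apply: sN; exact: nP.
by move: N0; rewrite NT probability_setT => /eqP; rewrite eqe oner_eq0.
Qed.

Lemma ae_prob1 (A : set T) : measurable A -> {ae Q, forall x, A x} <-> Q A = 1%:E.
Proof.
move=> mA; have -> : {ae Q, forall x, A x} = Q.-negligible (~` A) by [].
rewrite negligibleP; last exact: measurableC.
have e : Q (~` A) = (1 - fine (Q A))%:E.
  by rewrite probability_setC// {1}(fine_probE Q mA).
split=> [h|QA].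
  have : Q (~` A) = 0%E := h.
  rewrite e (fine_probE Q mA) => -[/eqP].
  by rewrite subr_eq0 => /eqP <-.
suff : Q (~` A) = 0%E by [].
by rewrite e QA/= subrr.
Qed.

Lemma ae_prob0 (A : set T) : measurable A -> {ae Q, forall x, ~ A x} <-> Q A = 0%:E.
Proof.
move=> mA; have -> : {ae Q, forall x, ~ A x} = Q.-negligible (~` (~` A)) by [].
by rewrite setCK negligibleP.
Qed.

Lemma ae_eq_prob (A B : set T) : measurable A -> measurable B ->
  {ae Q, forall x, A x <-> B x} -> Q A = Q B.
Proof.
wlog suff W : A B / measurable A -> measurable B ->
    {ae Q, forall x, A x <-> B x} -> (Q A <= Q B)%E.
  move=> mA mB AB; apply/eqP; rewrite eq_le !W//.
  by apply: filterS AB => x [].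
move=> mA mB AB; rewrite (measureDI Q mA mB)//.
rewrite [X in (X + _)%E](_ : _ = 0%E).
  by rewrite add0e le_measure// inE//; exact: measurableI.
apply/ae_prob0; first exact: measurableD.
by apply: filterS AB => x [h _] [/h].
Qed.

Lemma ae_forall_countable (I : countType) (P : I -> T -> Prop) :
  (forall i, {ae Q, forall x, P i x}) -> {ae Q, forall x, forall i, P i x}.
Proof.
move=> aeP.
suff : {ae Q, forall x, forall (n : nat) i, unpickle n = Some i -> P i x}.
  by apply: filterS => x h i; apply: (h (pickle i)); rewrite pickleK.
apply: ae_foralln => n; case: (unpickle n) => [i|]; last exact: aeW.
by apply: filterS (aeP i) => x Px _ [<-].
Qed.

End AE.

Section HewittSavage.
Context {R : realType} {d : nat}.
Local Notation vec := 'rV[R]_d.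
Local Notation X := (seqT R d).
Variable Q : probability X R.
Hypothesis iidQ : iid Q.

Lemma ae_reidx s (P : X -> Prop) : injective s ->
  {ae Q, forall x, P x} -> {ae Q, forall x, P (reidx s x)}.
Proof.
move=> injs [N [mN N0 sN]]; exists (reidx s @^-1` N); split.
- exact: measurable_reidx_preimage.
- by rewrite reidx_law.
- by move=> x /= nP; apply: sN.
Qed.

(** Involutions suffice for the block swaps below, and turn one-sided invariance into two-sided
    invariance. *)
Definition finitary (s : nat -> nat) :=
  involutive s /\ exists k, forall i, (k <= i)%N -> s i = i.

(** Exchanges [0, n) with the block of length [n] starting at [(m + 1) n]; these target blocks are
    disjoint for distinct [m]. *)
Definition block_swap (n m i : nat) : nat :=
  (if i < n then i + m.+1 * n
   else if m.+1 * n <= i < m.+1 * n + n then i - m.+1 * n else i)%N.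

Lemma finitary_block_swap n m : finitary (block_swap n m).
Proof.
split=> [i|]; last first.
  exists (m.+1 * n + n)%N => i le_i; rewrite /block_swap.
  case: ifP => h1; first by lia.
  by case: ifP => // h2; lia.
rewrite /block_swap.
have [i_n|n_i] := ltnP i n.
  rewrite (_ : (_ < n)%N = false); last by apply/negbTE; rewrite mulSn; lia.
  rewrite (_ : (_ <= _ < _)%N = true); last by lia.
  by lia.
case: (boolP (_ <= _ < _)%N) => h.
  rewrite (_ : (_ < n)%N = true); last by lia.
  by lia.
by rewrite (negbTE h) ltnNge n_i.
Qed.

(* The images of a rectangle on [0, n) under the block swaps are pairwise
   independent, and all meet [A] in the same probability. *)
Theorem hewitt_savage (A : set X) : measurable A ->
  (forall s, finitary s -> {ae Q, forall x, A x -> A (reidx s x)}) ->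
  Q A = 0%E \/ Q A = 1%E.
Proof.
move=> mA invA.
have indepA B : rectangles B -> (Q (A `&` B) = Q A * Q B)%E.
  move=> RB; have mB := measurable_rectangle RB.
  case: (RB) => n [b [mb EB]].
  pose Bs m := reidx (block_swap n m) @^-1` B.
  have injbs m : injective (block_swap n m).
    exact: inv_inj (finitary_block_swap n m).1.
  have mBs m : measurable (Bs m) by exact: measurable_reidx_preimage.
  have EBs m : Bs m = [set x | forall i, (i < n)%N -> b i (x (i + m.+1 * n)%N)].
    rewrite /Bs EB; apply/seteqP; split=> x /= h i lti; have := h i lti;
    by rewrite /reidx /block_swap lti.
  have mAB : measurable (A `&` B) by exact: measurableI.
  rewrite (fine_probE _ mA) (fine_probE _ mB) (fine_probE _ mAB) -EFinM.
  congr EFin.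
  apply: (@asymptotic_decoupling _ _ _ Q A Bs) => //.
  - exact: fine_probE.
  - by move=> m; rewrite reidx_law// -fine_probE.
  - move=> m l ml.
    (* The two copies read disjoint blocks, so they form a single rectangle on [2 n] coordinates
       read along the injection [sg]. *)
    pose sg i := if (i < n)%N then (i + m.+1 * n)%N else (i - n + l.+1 * n)%N.
    pose bb i := if (i < n)%N then b i else b (i - n)%N.
    have -> : Bs m `&` Bs l = [set x | forall i, (i < n + n)%N -> bb i (x (sg i))].
      rewrite !EBs; apply/seteqP; split=> x /=.
        move=> [h1 h2] i lti; rewrite /bb /sg; case: ifP => lin; first exact: h1.
        by apply: h2; lia.
      move=> h; split=> i lti.
        by have := h i; rewrite /bb /sg lti; apply; lia.
      have := h (i + n)%N; rewrite /bb /sg (ltnNge (i + n) n) leq_addl/= addnK; apply.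
      by rewrite ltn_add2r.
    rewrite iid_rect//; last 2 first.
    + move=> i j lti' ltj'; have lti : (i < n + n)%N := lti'.
      have ltj : (j < n + n)%N := ltj'; rewrite /sg {lti' ltj'}.
      case: ifP => li; case: ifP => lj.
      * by move/addIn.
      * move=> e; exfalso; move: ml; rewrite neq_ltn => /orP[] lt.
          have : (m.+2 * n <= l.+1 * n)%N by rewrite leq_mul2r; lia.
          by rewrite (mulSn m.+1); lia.
        have : (l.+2 * n <= m.+1 * n)%N by rewrite leq_mul2r; lia.
        by rewrite (mulSn l.+1); lia.
      * move=> e; exfalso; move: ml; rewrite neq_ltn => /orP[] lt.
          have : (m.+2 * n <= l.+1 * n)%N by rewrite leq_mul2r; lia.
          by rewrite (mulSn m.+1); lia.
        have : (l.+2 * n <= m.+1 * n)%N by rewrite leq_mul2r; lia.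
        by rewrite (mulSn l.+1); lia.
      * by move/addIn; lia.
    + by move=> i; rewrite /bb; case: ifP.
    rewrite big_split_ord/=.
    have QB : Q B = (\prod_(i < n) Q [set x | b i (x 0%N)])%E.
      by rewrite EB -(iid_rect iidQ (s := id)).
    rewrite EFinM -fine_probE// QB; congr (_ * _)%E.
      by apply: eq_bigr => i _; rewrite /bb ltn_ord.
    by apply: eq_bigr => i _; rewrite /bb ltnNge leq_addr/= addKn.
  - move=> m.
    have fs := finitary_block_swap n m.
    transitivity (Q (reidx (block_swap n m) @^-1` (A `&` B))); last first.
      by rewrite reidx_law// -fine_probE.
    apply: ae_eq_prob.
    + exact: measurableI.
    + exact: measurable_reidx_preimage.
    (* Invariance is assumed in one direction only; used at the swapped sequence it gives the
       other. *)
    have aeA := invA _ fs; have aeA' := ae_reidx (injbs m) aeA.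
    apply: filterS2 aeA aeA' => x h1 h2.
    split=> -[Ax Bx]; split=> //; first exact: h1.
    have := h2 Ax; rewrite (_ : reidx _ (reidx _ x) = x)//.
    by apply/funext => i; rewrite /reidx fs.1.
have a0 : 0 <= fine (Q A) by exact/fine_ge0/measure_ge0.
(* Independence of [A] from rectangles extends to all events, hence to [A] itself, so that [Q A]
   equals its square. *)
have : mrestr Q mA A = mscale (NngNum a0) Q A.
  have mA' : <<s rectangles >> A by rewrite -measurable_seqTE.
  apply: (@g_sigma_algebra_measure_unique _ _ _ rectangles _ (fun=> setT)) => //.
  - exact: measurable_rectangle.
  - by move=> _; exact: rectangle_setT.
  - by rewrite bigcup_const.
  - exact: rectangles_setI.
  - move=> B RB; transitivity (Q A * Q B)%E; last by rewrite [in LHS](fine_probE Q mA).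
    by rewrite -indepA// setIC.
  - move=> _; rewrite [X in (X < _)%E](_ : _ = Q (setT `&` A))// setTI.
    by rewrite (fine_probE Q mA) ltry.
move=> e; have {e} : Q (A `&` A) = ((fine (Q A))%:E * Q A)%E := e.
rewrite setIid; move: (fine_probE Q mA); set a := fine (Q A) => -> -[].
move/eqP; rewrite -subr_eq0 -[X in X - _]mul1r -mulrBl mulf_eq0 subr_eq0.
by move=> /orP[] /eqP; [move=> <-; right|move=> ->; left].
Qed.

(** Almost surely every rational cut of [g x] is the one prescribed by the probabilities, and an
    extended real is determined by its rational cuts. *)
Lemma ae_constant (g : X -> \bar R) :
  (forall q : R, measurable [set x | (q%:E < g x)%E]) ->
  (forall s, finitary s -> {ae Q, forall x, g (reidx s x) = g x}) ->
  exists c, {ae Q, forall x, g x = c}.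
Proof.
move=> mg invg.
have z1 (q : R) : Q [set x | (q%:E < g x)%E] = 0%E \/ Q [set x | (q%:E < g x)%E] = 1%E.
  apply: hewitt_savage => // s /invg; apply: filterS => x /= ->.
  by [].
pose good x := forall r : rat,
  ((ratr r)%:E < g x)%E <-> Q [set x | ((ratr r)%:E < g x)%E] = 1%E.
have aeg : {ae Q, forall x, good x}.
  apply: (ae_forall_countable (P := fun (r : rat) x => _)) => r.
  have [Q0|Q1] := z1 (ratr r).
    have := (ae_prob0 Q (mg (ratr r))).2 Q0; apply: filterS => x /= nx.
    split=> // /eqP; rewrite Q0 eqe eq_sym oner_eq0//.
  have := (ae_prob1 Q (mg (ratr r))).2 Q1; apply: filterS => x /= nx.
  by split.
have [x0 gx0] := ae_inhabited aeg.
exists (g x0); apply: filterS aeg => x gx.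
have W y z : good y -> good z -> (g y <= g z)%E.
  move=> gy gz; rewrite leNgt; apply/negP => lt.
  have [r h1 h2] : exists2 r : rat, ((ratr r)%:E < g y)%E & (g z <= (ratr r)%:E)%E.
    case: (g y) (g z) lt => [a| |] [b| |]//=.
    - rewrite lte_fin => /rat_in_itvoo[r]; rewrite in_itv/= => /andP[h1 h2].
      by exists r; rewrite ?lte_fin// lee_fin ltW.
    - have /rat_in_itvoo[r] : a - 1 < a by rewrite ltrBlDr ltrDl.
      rewrite in_itv/= => /andP[h1 h2] _.
      by exists r; rewrite ?lte_fin ?leNye.
    - have /rat_in_itvoo[r] : b < b + 1 by rewrite ltrDl.
      rewrite in_itv/= => /andP[h1 h2] _.
      by exists r; rewrite ?ltry// lee_fin ltW.
    - by exists 0; rewrite ?ltry ?leNye.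
  by move: h2; rewrite leNgt (gz r).2// -(gy r).
by apply/eqP; rewrite eq_le !W.
Qed.

End HewittSavage.

(** * Birkhoff sums and random walks *)

Section Dot.
Context {R : realType} {d : nat}.
Local Notation vec := 'rV[R]_d.
Local Notation X := (seqT R d).

Definition dot (u v : vec) : R := \sum_(i < d) u 0 i * v 0 i.

Lemma dotC u v : dot u v = dot v u.
Proof. by apply: eq_bigr => i _; rewrite mulrC. Qed.

Lemma dotDr u v w : dot u (v + w) = dot u v + dot u w.
Proof. by rewrite -big_split; apply: eq_bigr => i _; rewrite mxE mulrDr. Qed.

Lemma dotZr a u v : dot u (a *: v) = a * dot u v.
Proof. by rewrite big_distrr; apply: eq_bigr => i _; rewrite mxE mulrCA. Qed.

Lemma dotDl u v w : dot (u + v) w = dot u w + dot v w.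
Proof. by rewrite dotC dotDr !(dotC w). Qed.

Lemma dotZl a u v : dot (a *: u) v = a * dot u v.
Proof. by rewrite dotC dotZr dotC. Qed.

Lemma dot0r u : dot u 0 = 0.
Proof. by rewrite -(scale0r 0) dotZr mul0r. Qed.

Lemma dot0l u : dot 0 u = 0. Proof. by rewrite dotC dot0r. Qed.

Lemma dotNr u v : dot u (- v) = - dot u v.
Proof. by rewrite -scaleN1r dotZr mulN1r. Qed.

Lemma dotNl u v : dot (- u) v = - dot u v.
Proof. by rewrite dotC dotNr dotC. Qed.

Lemma dotBr u v w : dot u (v - w) = dot u v - dot u w.
Proof. by rewrite dotDr dotNr. Qed.

Lemma dotBl u v w : dot (u - v) w = dot u w - dot v w.
Proof. by rewrite dotDl dotNl. Qed.

Lemma dot_sumr (I : Type) (r : seq I) (P : pred I) u (f : I -> vec) :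
  dot u (\sum_(i <- r | P i) f i) = \sum_(i <- r | P i) dot u (f i).
Proof.
by elim/big_rec2: _ => [|i y z _ <-]; rewrite ?dot0r// dotDr.
Qed.

Lemma measurable_entry i j : measurable_fun setT (fun x : X => x i 0 j).
Proof.
apply: (measurability _ (RGenOInfty.measurableE R)).
move=> _ [_ [a ->] <-]; rewrite setTI.
rewrite (_ : _ @^-1` _ = [set x : X | [set v : vec | a < v 0 j] (x i)]); last first.
  by apply/seteqP; split=> x /=; rewrite in_itv/= andbT.
apply: measurable_coord; apply: sub_sigma_algebra.
rewrite /= (_ : [set v : vec | _] = (fun v : vec => v 0 j) @^-1` [set y | a < y])//.
apply: open_comp; last exact: open_gt.
by move=> v _; exact: coord_continuous.
Qed.

Lemma measurable_dot_coord u i : measurable_fun setT (fun x : X => dot u (x i)).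
Proof.
apply: measurable_sum => j; apply: measurable_funM => //.
exact: measurable_entry.
Qed.

Definition psum (n : nat) (x : nat -> vec) : vec := \sum_(i < n) x i.

Lemma dot_psum u n x : dot u (psum n x) = \sum_(i < n) dot u (x i).
Proof. exact: dot_sumr. Qed.

Lemma measurable_dot_psum u n : measurable_fun setT (fun x : X => dot u (psum n x)).
Proof.
rewrite (_ : (fun x => _) = (fun x : X => \sum_(i < n) dot u (x i))).
  by apply: measurable_sum => i; exact: measurable_dot_coord.
by apply/funext => x; exact: dot_psum.
Qed.

End Dot.

(** * Garsia's maximal inequality for the shift *)

Section Maximal.
Context {R : realType} {d : nat}.
Local Notation X := (seqT R d).
Variable Q : probability X R.
Hypothesis iidQ : iid Q.

Definition shift : X -> X := reidx succn.

Lemma integral_reidx s (f : X -> \bar R) : injective s -> Q.-integrable setT f ->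
  Q.-integrable setT (f \o reidx s) /\
  (\int[Q]_x f (reidx s x) = \int[Q]_x f x)%E.
Proof.
move=> injs intf; have mf := measurable_int _ intf.
have mfs : measurable_fun setT (f \o reidx s).
  by apply: measurableT_comp => //; exact: measurable_reidx.
have ints : Q.-integrable setT (f \o reidx s).
  apply/integrableP; split => //.
  move/integrableP: intf => [_]; apply: le_lt_trans.
  rewrite [leRHS](_ : _ = (\int[pushforward Q (reidx s)]_x `|f x|)%E).
    rewrite ge0_integral_pushforward//.
    - exact: measurable_reidx.
    - exact: measurableT_comp.
  apply: eq_measure_integral; first exact: measurable_reidx.
  by move=> ? A mA _; exact/esym/reidx_law.
split=> //.
transitivity (\int[pushforward Q (reidx s)]_x f x)%E.
  exact/esym/(@integral_pushforward _ _ _ _ _ _ (measurable_reidx s) Q setT f mf ints).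
apply: eq_measure_integral; first exact: measurable_reidx.
by move=> ? A mA _; exact/reidx_law.
Qed.

Definition birkhoff (g : X -> R) n (x : X) := \sum_(i < n) g (reidx (addn i) x).

(** The maximum of the Birkhoff sums of orders 0 to [n], given by a recursion so that its increment
    along the shift is explicit. *)
Fixpoint runmax (g : X -> R) n (x : X) : R :=
  if n is n'.+1 then Num.max 0 (g x + runmax g n' (shift x)) else 0.

Lemma birkhoffS g n x : birkhoff g n.+1 x = g x + birkhoff g n (shift x).
Proof.
by rewrite /birkhoff big_ord_recl.
Qed.

Lemma runmax_ge0 g n x : 0 <= runmax g n x.
Proof. by case: n => //= n; rewrite le_max lexx. Qed.

Lemma birkhoff_le_runmax g k n x : (k <= n)%N -> birkhoff g k x <= runmax g n x.
Proof.
elim: n k x => [|n IH] [|k] x // kn; rewrite ?[birkhoff g 0 _]big_ord0//.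
  exact: runmax_ge0.
by rewrite birkhoffS /= le_max lerD2l IH ?orbT.
Qed.

Lemma measurable_runmax g n : measurable_fun setT g ->
  measurable_fun setT (runmax g n).
Proof.
move=> mg; elim: n => [|n IH] /=; first exact: measurable_cst.
apply: measurable_maxr; first exact: measurable_cst.
by apply: measurable_funD => //; apply: measurableT_comp => //; exact: measurable_reidx.
Qed.

Lemma integrable_runmax g n : Q.-integrable setT (EFin \o g) ->
  Q.-integrable setT (EFin \o runmax g n).
Proof.
move=> intg.
have /measurable_EFinP mg := measurable_int _ intg.
elim: n => [|n IH]; first exact: (integrable0 Q setT).
have [intS _] := integral_reidx succn_inj IH.
have intG := integrableD measurableT (integrable_abse intg) (integrable_abse intS).
apply: (le_integrable _ _ _ intG) => //.
  by apply/measurable_EFinP; exact: measurable_runmax.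
move=> x _; rewrite lee_fin -/(runmax g n.+1 x).
rewrite ger0_norm ?(runmax_ge0 g n.+1)// ge_max; apply/andP; split=> //.
rewrite (le_trans _ (ler_norm _))// lerD// ler_norm//.
Qed.

(* [runmax g n.+1 - runmax g n \o shift = max (- runmax g n \o shift) g] has
   nonnegative mean, and tends to [g] where the Birkhoff sums are unbounded. *)
Lemma unbounded_birkhoff_mean_ge0 (g : X -> R) : Q.-integrable setT (EFin \o g) ->
  {ae Q, forall x, forall C, exists n, C < birkhoff g n x} ->
  (0 <= \int[Q]_x (g x)%:E)%E.
Proof.
move=> intg unb.
have /measurable_EFinP mg := measurable_int _ intg.
pose h n x := Num.max (- runmax g n (shift x)) (g x).
have hE n x : h n x = runmax g n.+1 x - runmax g n (shift x).
  rewrite /h /=; set a := runmax _ _ _.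
  by rewrite maxEle [in RHS]maxEle; case: ifP => h1; case: ifP => h2; lra.
have inth n : (0 <= \int[Q]_x (h n x)%:E)%E.
  have i1 := integrable_runmax n.+1 intg.
  have [i2 e2] := integral_reidx succn_inj (integrable_runmax n intg).
  rewrite [leRHS](_ : _ = (\int[Q]_x ((EFin \o runmax g n.+1) x -
      (EFin \o runmax g n) (reidx succn x)))%E); last first.
    by apply: eq_integral => x _; rewrite hE EFinB.
  rewrite integralB// e2 sube_ge0; last first.
    by rewrite integrable_fin_num// integrable_runmax.
  apply: le_integral => //; first exact: integrable_runmax.
  move=> x _; rewrite lee_fin {i1 i2 e2}.
  elim: n x => [|n IH] x; first exact: runmax_ge0.
  by rewrite /= ge_max !le_max lexx/= lerD2l IH orbT.
have [] := @dominated_convergence _ _ _ Q setT measurableT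
  (fun n x => (h n x)%:E) (EFin \o g) (fun x => `|(g x)%:E|%E).
- move=> n; apply/measurable_EFinP; apply: measurable_maxr => //.
  apply: measurableT_comp => //; apply: measurableT_comp; first exact: measurable_runmax.
  exact: measurable_reidx.
- exact/measurable_EFinP.
- have := ae_reidx iidQ succn_inj unb; apply: filterS => x unbx _.
  have [N /= gN] := unbx (- g x).
  apply: cvg_near_cst; near=> n; congr EFin.
  rewrite /h; apply/max_idPr; rewrite lerNl.
  apply: (le_trans (ltW gN)); apply: birkhoff_le_runmax.
  by near: n; exact: nbhs_infty_ge.
- exact: integrable_abse.
- apply: aeW => x n _; rewrite /= lee_fin.
  (* As [a] is nonnegative, a value [- a] above [g x] is closer to 0 than [g x] is. *)
  have := runmax_ge0 g n (shift x); rewrite /h; set a := runmax _ _ _ => a0.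
  rewrite maxEle; case: (lerP (- a) (g x)) => // h1.
  by rewrite normrN ger0_norm// ltr0_norm; lra.
move=> _ _ /= cv.
by apply: cvge_ge cv; apply: nearW.
Unshelve. all: by end_near. Qed.

End Maximal.

(** * One-dimensional projections of the walk *)

Section Walk.
Context {R : realType} {d : nat}.
Local Notation vec := 'rV[R]_d.
Local Notation X := (seqT R d).

Lemma psum_finitary s k (x : X) n : involutive s ->
  (forall i, (k <= i)%N -> s i = i) -> (k <= n)%N ->
  psum n (reidx s x) = psum n x.
Proof.
move=> sK sk kn.
have sn i : (i < n)%N -> (s i < n)%N.
  move=> lti; rewrite ltnNge; apply/negP => le.
  have := sk _ (leq_trans kn le); rewrite sK => e.
  by move: lti; rewrite e ltnNge le.
pose f (i : 'I_n) := Ordinal (sn i (ltn_ord i)).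
rewrite /psum [RHS](reindex_inj (h := f)) //.
by move=> i j /(congr1 val)/= /(inv_inj sK) /val_inj.
Qed.

Lemma psum_addn n j (x : X) : psum j (reidx (addn n) x) = psum (n + j) x - psum n x.
Proof. by rewrite /psum big_split_ord/= addrAC subrr add0r. Qed.

Lemma psum_shift n (x : X) : psum n.+1 x = x 0%N + psum n (shift x).
Proof. by rewrite /psum big_ord_recl. Qed.

Lemma eq_tail_bounded (a b : nat -> R) k :
  (forall n, (k <= n)%N -> a n = b n) ->
  (exists C, forall n, a n <= C) -> exists C, forall n, b n <= C.
Proof.
move=> ab [C aC]; exists (`|C| + \sum_(i < k) `|b i|) => n.
have [kn|nk] := leqP k n.
  rewrite -ab// (le_trans (aC n))// (le_trans (ler_norm _))// lerDl.
  by apply: sumr_ge0.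
rewrite (bigD1 (Ordinal nk))//= addrCA (le_trans (ler_norm _))// lerDl.
by rewrite addr_ge0// sumr_ge0.
Qed.

Lemma birkhoff_dot u c n (x : X) :
  birkhoff (fun x : X => dot u (x 0%N) - c) n x = dot u (psum n x) - c * n%:R.
Proof.
rewrite /birkhoff sumrB sumr_const card_ord dot_psum mulr_natr; congr (_ - _).
by apply: eq_bigr => i _; rewrite /reidx addn0.
Qed.

(** Only boundedness from above, after removal of a drift [c]; finitary permutations preserve it, so
    the zero-one law applies. *)
Definition walk_bounded (u : vec) (c : R) (x : X) :=
  exists C, forall n, dot u (psum n x) - c * n%:R <= C.

Lemma measurable_walk_bounded u c : measurable [set x | walk_bounded u c x].
Proof.
rewrite (_ : [set _ | _] =
    \bigcup_N \bigcap_n [set x | dot u (psum n x) - c * n%:R <= N%:R]).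
  apply: bigcupT_measurable => N; apply: bigcapT_measurable => n.
  rewrite -[X in measurable X]setTI.
  apply: (measurable_fun_le measurableT); last exact: measurable_cst.
  by apply: measurable_funB => //; exact: measurable_dot_psum.
apply/seteqP; split=> x /=.
  move=> [C xC]; exists (Num.truncn C).+1 => // n _ /=.
  by rewrite (le_trans (xC n))// ltW// truncnS_gt.
by move=> [N _ h]; exists N%:R => n; exact: h.
Qed.

Lemma walk_bounded_finitary u c s x : finitary s ->
  walk_bounded u c x -> walk_bounded u c (reidx s x).
Proof.
move=> [sK [k sk]]; apply: (@eq_tail_bounded _ _ k) => n kn.
by rewrite (psum_finitary _ sK sk kn).
Qed.

Variable Q : probability X R.
Hypothesis iidQ : iid Q.
Variable mu : vec.
Hypothesis int_dot : forall u, Q.-integrable setT (fun x => (dot u (x 0%N))%:E).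
Hypothesis mean_dot : forall u, (\int[Q]_x (dot u (x 0%N))%:E = (dot u mu)%:E)%E.

(** The alternative left by the zero-one law is almost sure unboundedness, which the maximal
    inequality allows only if the mean [dot u mu - c] is nonnegative. *)
Lemma walk_bounded_drift u c : dot u mu < c ->
  {ae Q, forall x, walk_bounded u c x}.
Proof.
move=> uc; have mA := measurable_walk_bounded u c.
have [|Q0|Q1] := hewitt_savage iidQ mA.
- by move=> s fs; apply: aeW => x; exact: walk_bounded_finitary.
- pose g (x : X) := dot u (x 0%N) - c.
  have intc : Q.-integrable setT (cst c%:E) by exact: finite_measure_integrable_cst.
  have intg : Q.-integrable setT (EFin \o g) by exact: (integrableB _ (int_dot u) intc).
  have : (0 <= \int[Q]_x (g x)%:E)%E.
    apply: unbounded_birkhoff_mean_ge0 => //.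
    have := (ae_prob0 Q mA).2 Q0; apply: filterS => x nb C.
    apply: contrapT => /forallNP h; apply: nb; exists C => n.
    by move/negP: (h n); rewrite -leNgt birkhoff_dot.
  rewrite (_ : (\int[Q]_x _)%E = (dot u mu - c)%:E).
    by rewrite lee_fin leNgt subr_lt0 uc.
  rewrite -[LHS]/(\int[Q]_x ((dot u (x 0%N))%:E - (cst c%:E) x))%E.
  rewrite integralB// mean_dot integral_cst//.
  by rewrite [X in (_ - _ * X)%E](_ : _ = 1%E) ?mule1//; exact: probability_setT.
- exact/ae_prob1.
Qed.

(** When no shift of the path lies here, every value of the walk is later regained or exceeded, up
    to [eta]. *)
Definition drops (u : vec) (eta : R) : set X :=
  [set x | forall j, dot u (psum j.+1 x) <= - eta].

Lemma measurable_drops u eta : measurable (drops u eta).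
Proof.
rewrite (_ : drops _ _ = \bigcap_j [set x : X | dot u (psum j.+1 x) <= - eta]).
  apply: bigcapT_measurable => j; rewrite -[X in measurable X]setTI.
  apply: (measurable_fun_le measurableT); last exact: measurable_cst.
  exact: measurable_dot_psum.
by apply/seteqP; split=> x h j; [move=> _; exact: h|exact: (h j I)].
Qed.

(* Each time from which the walk drops by [eta] forever lowers all later
   values by [eta]. *)
Lemma psum_drops u eta (x : X) M : (forall n, dot u (psum n x) <= M) ->
  forall n j, (n <= j)%N ->
  dot u (psum j x) + eta * (\sum_(i < n) \1_(drops u eta) (reidx (addn i) x)) <= M.
Proof.
move=> xM; elim=> [|n IH] j nj; first by rewrite big_ord0 mulr0 addr0.
rewrite big_ord_recr/= indicE; case: (boolP (_ \in _)) => [|_]; last first.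
  by rewrite addr0; apply: IH; exact: ltnW.
rewrite inE => /(_ (j - n.+1)%N); rewrite psum_addn.
rewrite (_ : (n + (j - n.+1).+1)%N = j); last by lia.
rewrite dotBr mulrDr mulr1 => h; apply: le_trans (IH n (leqnn n)).
by rewrite addrA [leLHS]addrAC lerD2r; lra.
Qed.

(** By [psum_drops] the projected walk plus [eta] times the number of drops stays bounded above,
    although its mean would grow linearly if drops had positive probability. *)
Lemma drops_negligible u eta : dot u mu = 0 -> 0 < eta ->
  {ae Q, forall x, walk_bounded u 0 x} -> Q (drops u eta) = 0%E.
Proof.
move=> u0 eta0 bnd; have mA := measurable_drops u eta.
apply/eqP; apply: contraT => QA0.
have p0 : 0 < fine (Q (drops u eta)).
  rewrite lt_neqAle fine_ge0 ?measure_ge0// andbT eq_sym.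
  by apply: contra QA0; rewrite {2}(fine_probE Q mA) => /eqP ->.
set p := fine _ in p0.
(* Half of [eta * p]: the Birkhoff sums of [g] are at least [n * delta - M], while its mean is
   [delta - eta * p = - delta]. *)
pose delta := eta * p / 2.
pose g (x : X) := (delta - dot u (x 0%N)) - eta * \1_(drops u eta) x.
have i1 : Q.-integrable setT (cst delta%:E) by exact: finite_measure_integrable_cst.
have i2 : Q.-integrable setT (fun x => (eta%:E * (\1_(drops u eta) x)%:E)%E).
  by apply: integrableZl => //; exact: integrable_indic.
have i3 : Q.-integrable setT (fun x => (cst delta%:E x - (dot u (x 0%N))%:E)%E).
  exact: integrableB.
have intg : Q.-integrable setT (EFin \o g) by exact: (integrableB _ i3 i2).
have : (0 <= \int[Q]_x (g x)%:E)%E.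
  apply: unbounded_birkhoff_mean_ge0 => //.
  apply: filterS bnd => x [M xM] C.
  have {}xM n : dot u (psum n x) <= M by have := xM n; rewrite mul0r subr0.
  have d0 : 0 < delta by rewrite divr_gt0// mulr_gt0.
  pose n := (Num.truncn ((C + M) / delta)).+1; exists n.
  have := psum_drops eta xM (leqnn n).
  have : (C + M) < n%:R * delta by rewrite -ltr_pdivrMr// truncnS_gt.
  have -> : birkhoff g n x = n%:R * delta - (dot u (psum n x)
      + eta * (\sum_(i < n) \1_(drops u eta) (reidx (addn i) x))).
    rewrite /birkhoff /g !sumrB sumr_const card_ord -mulr_sumr mulr_natl dot_psum.
    rewrite opprD addrA; congr (_ - _ - _).
    by apply: eq_bigr => i _; rewrite /reidx addn0.
  by lra.
rewrite (_ : (\int[Q]_x _)%E = (- delta)%:E).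
  by rewrite lee_fin oppr_ge0 leNgt divr_gt0// mulr_gt0.
rewrite -[LHS]/(\int[Q]_x ((cst delta%:E x - (dot u (x 0%N))%:E)
                         - (eta%:E * (\1_(drops u eta) x)%:E)))%E.
rewrite integralB// integralB// mean_dot u0 integral_cst// integralZl//; last first.
  exact: integrable_indic.
rewrite integral_indic// setIT.
rewrite [X in (_ * X - _ - _)%E](_ : _ = 1%E) ?mule1; last exact: probability_setT.
rewrite [X in (_ - _ * X)%E](_ : _ = p%:E); last exact: fine_probE.
by rewrite -EFinM -!EFinB; congr EFin; rewrite /delta; lra.
Qed.

Lemma recurrent_tail_sup (a : nat -> R) :
  (forall i (eps : R), 0 < eps -> exists j, a i - eps < a (i + j.+1)%N) ->
  forall k i (eps : R), 0 < eps -> exists2 j, (k <= j)%N & a i - eps < a j.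
Proof.
move=> h; elim=> [|k IH] i eps e0; first by exists i => //; lra.
have e2 : 0 < eps / 2 by rewrite divr_gt0.
have [j kj aj] := IH i _ e2; have [l al] := h j _ e2.
by exists (j + l.+1)%N; [lia|lra].
Qed.

(* A bounded driftless walk returns arbitrarily close to its supremum after
   any time, so that its supremum is finitary, hence constant; comparing the
   walk with its shift, its first step vanishes. *)
Theorem driftless_unbounded u : dot u mu = 0 ->
  Q [set x | dot u (x 0%N) != 0] != 0%E ->
  {ae Q, forall x, ~ walk_bounded u 0 x}.
Proof.
move=> u0 ndeg; have mA := measurable_walk_bounded u 0.
have [|Q0|Q1] := hewitt_savage iidQ mA.
- by move=> s fs; apply: aeW => x; exact: walk_bounded_finitary.
- exact/ae_prob0.
exfalso.
have bnd : {ae Q, forall x, walk_bounded u 0 x} by exact/ae_prob1.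
pose a (x : X) n := dot u (psum n x).
pose rec (x : X) := forall (i : nat) (eps : R),
  0 < eps -> exists j, a x i - eps < a x (i + j.+1)%N.
have aerec : {ae Q, forall x, rec x}.
  have : {ae Q, forall x, forall i m, ~ drops u m.+1%:R^-1 (reidx (addn i) x)}.
    apply: ae_foralln => i; apply: ae_foralln => m.
    apply: (@ae_reidx _ _ Q iidQ _ (fun x => ~ drops u m.+1%:R^-1 x) (@addnI i)).
    apply/ae_prob0; first exact: measurable_drops.
    by apply: drops_negligible => //; rewrite invr_gt0.
  apply: filterS => x h i eps e0.
  have := h i (Num.truncn eps^-1).
  move/existsNP => [j /negP]; rewrite -ltNge psum_addn dotBr => hj.
  exists j; rewrite /a.
  have : (Num.truncn eps^-1).+1%:R^-1 < eps.
    by rewrite invf_plt ?posrE// truncnS_gt.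
  by rewrite ltrNl opprB in hj => /(lt_trans hj); rewrite ltrBlDr ltrBlDl addrC.
pose g (x : X) := ereal_sup (range (fun n => (a x n)%:E)).
have sup_tail (x y : X) k : rec x -> (forall n, (k <= n)%N -> a x n = a y n) ->
    (g x <= g y)%E.
  move=> recx xy; apply: ge_ereal_sup => _ [i _ <-].
  apply/lee_addgt0Pr => e e0.
  have [j kj aj] := recurrent_tail_sup recx k i e0.
  apply: (@le_trans _ _ ((a y j)%:E + e%:E)%E).
    by rewrite -EFinD lee_fin -xy//; lra.
  by rewrite leeD2r//; apply: ereal_sup_ubound; exists j.
have [c gc] : exists c, {ae Q, forall x, g x = c}.
  apply: ae_constant => //.
  - move=> q; rewrite (_ : [set x | _] = \bigcup_n [set x | q < a x n]).
      apply: bigcupT_measurable => n; apply: measurable_superlevel.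
      exact: measurable_dot_psum.
    apply/seteqP; split=> x /=.
      by move=> /ereal_sup_gt[_ [n _ <-]]; rewrite lte_fin => h; exists n.
    move=> [n _ /= h]; apply: (@lt_le_trans _ _ (a x n)%:E); first by rewrite lte_fin.
    by apply: ereal_sup_ubound; exists n.
  - move=> s [sK [k sk]].
    have aerec' := ae_reidx iidQ (inv_inj sK) aerec.
    apply: filterS2 aerec aerec' => x rx rsx.
    have e n : (k <= n)%N -> a x n = a (reidx s x) n.
      by move=> kn; rewrite /a (psum_finitary _ sK sk kn).
    by apply/eqP; rewrite eq_le; apply/andP; split; apply: (sup_tail _ _ k) => // n /e.
have gc' := ae_reidx iidQ succn_inj gc.
move/eqP: ndeg; apply; apply/ae_prob0.
  rewrite (_ : [set x | _] = ~` [set x : X | dot u (x 0%N) = 0]); last first.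
    by apply/seteqP; split=> x /=; [move/eqP|move/eqP].
  apply: measurableC; rewrite -[X in measurable X]setTI.
  exact: (@measurable_dot_coord _ _ u 0%N measurableT [set 0]).
have := filterS3 _ _ bnd aerec (filterI gc gc'); apply => x [M xM] rx [gx gsx].
have {}xM n : a x n <= M by have := xM n; rewrite mul0r subr0.
have cM : (c <= M%:E)%E.
  by rewrite -gx; apply: ge_ereal_sup => _ [n _ <-]; rewrite lee_fin.
have c0 : (0 <= c)%E.
  rewrite -gx; apply: ereal_sup_ubound; exists 0%N => //.
  by rewrite /a /psum big_ord0 dot0r.
have [r cr] : exists r, c = r%:E by case: (c) c0 cM => // r _ _; exists r.
apply/negP; rewrite negbK.
have ax n : a x n <= r.
  by rewrite -lee_fin -cr -gx; apply: ereal_sup_ubound; exists n.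
have asx n : a (shift x) n <= r.
  by rewrite -lee_fin -cr -gsx; apply: ereal_sup_ubound; exists n.
have E n : a x n.+1 = dot u (x 0%N) + a (shift x) n.
  by rewrite /a psum_shift dotDr.
(* Only the positive times of [x] correspond to times of its shift; recurrence lets the supremum be
   approached at those. *)
have supx e : 0 < e -> exists n, r - e < a x n.+1.
  move=> e0; have e2 : 0 < e / 2 by rewrite divr_gt0.
  have : ((r - e / 2)%:E < g x)%E by rewrite gx cr lte_fin; lra.
  move=> /ereal_sup_gt[_ [i _ <-]]; rewrite lte_fin => hi.
  have [[|j] // _ hj] := recurrent_tail_sup rx 1 i e2.
  by exists j; lra.
have supsx e : 0 < e -> exists n, r - e < a (shift x) n.
  move=> e0; have : ((r - e)%:E < g (shift x))%E.
    by rewrite [g _]gsx cr lte_fin; lra.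
  by move=> /ereal_sup_gt[_ [i _ <-]]; rewrite lte_fin => hi; exists i.
rewrite eq_le; apply/andP; split; rewrite leNgt; apply/negP => h.
  have [n hn] := supsx _ h; have := ax n.+1; rewrite E; lra.
have [n hn] : exists n, r - - dot u (x 0%N) < a x n.+1 by apply: supx; rewrite oppr_gt0.
by have := asx n; rewrite E in hn; lra.
Qed.

End Walk.

(** * Euclidean geometry and compactness *)

Section Euclid.
Context {R : realType} {d : nat}.
Local Notation vec := 'rV[R]_d.
Implicit Types u v w : vec.

Lemma dot_ge0 u : 0 <= dot u u.
Proof. by apply: sumr_ge0 => i _; rewrite -expr2 sqr_ge0. Qed.

Lemma enormE u : enorm u = Num.sqrt (dot u u).
Proof. by []. Qed.

Lemma enorm_ge0 u : 0 <= enorm u. Proof. exact: sqrtr_ge0. Qed.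

Lemma enorm_sqr u : enorm u ^+ 2 = dot u u.
Proof. by rewrite enormE sqr_sqrtr// dot_ge0. Qed.

Lemma entry_le_enorm u i : `|u 0 i| <= enorm u.
Proof.
rewrite -[leLHS]sqrtr_sqr ler_sqrt; last exact: dot_ge0.
rewrite [leRHS](bigD1 i)//= lerDl; apply: sumr_ge0 => j _.
exact: sqr_ge0.
Qed.

Lemma enorm_eq0 u : (enorm u == 0) = (u == 0).
Proof.
apply/eqP/eqP => [u0|->]; last by rewrite enormE dot0r sqrtr0.
apply/rowP => i; rewrite mxE; apply/eqP; rewrite -normr_le0 -u0.
exact: entry_le_enorm.
Qed.

Lemma enorm0 : enorm (0 : vec) = 0.
Proof. by apply/eqP; rewrite enorm_eq0. Qed.

Lemma enorm_gt0 u : (0 < enorm u) = (u != 0).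
Proof. by rewrite lt_neqAle enorm_ge0 andbT eq_sym enorm_eq0. Qed.

Lemma cauchy_schwarz u v : dot u v <= enorm u * enorm v.
Proof.
have [->|u0] := eqVneq u 0; first by rewrite dot0l enorm0 mul0r.
have [->|v0] := eqVneq v 0; first by rewrite dot0r enorm0 mulr0.
rewrite -enorm_gt0 in u0; rewrite -enorm_gt0 in v0.
have := dot_ge0 (enorm v *: u - enorm u *: v).
rewrite dotBl !dotBr !dotZl !dotZr -!enorm_sqr (dotC v u).
set a := enorm u in u0 *; set b := enorm v in v0 *; set c := dot u v => H.
have {}H : 0 <= a * b * (a * b - c) by move: H; nra.
by rewrite pmulr_rge0 ?mulr_gt0// subr_ge0 in H.
Qed.

Lemma enormZ a u : enorm (a *: u) = `|a| * enorm u.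
Proof.
by rewrite !enormE dotZl dotZr mulrA -expr2 sqrtrM ?sqr_ge0// sqrtr_sqr.
Qed.

Lemma enormN u : enorm (- u) = enorm u.
Proof. by rewrite -scaleN1r enormZ normrN1 mul1r. Qed.

Lemma enormD u v : enorm (u + v) <= enorm u + enorm v.
Proof.
rewrite -(@ler_pXn2r _ 2)// ?nnegrE ?enorm_ge0 ?addr_ge0 ?enorm_ge0//.
rewrite enorm_sqr dotDl !dotDr (dotC v u) -!enorm_sqr.
by have := cauchy_schwarz u v; nra.
Qed.

Lemma enorm_distC u v : enorm (u - v) = enorm (v - u).
Proof. by rewrite -enormN opprB. Qed.

Lemma enorm_sum (I : Type) (r : seq I) (P : pred I) (f : I -> vec) :
  enorm (\sum_(i <- r | P i) f i) <= \sum_(i <- r | P i) enorm (f i).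
Proof.
elim/big_rec2: _ => [|i y z _ h]; first by rewrite enorm0.
by rewrite (le_trans (enormD _ _))// lerD2l.
Qed.

Lemma abs_dot u v : `|dot u v| <= enorm u * enorm v.
Proof.
rewrite ler_norml cauchy_schwarz andbT lerNl -dotNl -(enormN u).
exact: cauchy_schwarz.
Qed.

Lemma enorm_le_sum u : enorm u <= \sum_i `|u 0 i|.
Proof.
rewrite -(@ler_pXn2r _ 2)// ?nnegrE ?enorm_ge0 ?sumr_ge0//.
rewrite enorm_sqr expr2 mulr_suml; apply: ler_sum => i _.
rewrite -expr2 -real_normK ?num_real// expr2 ler_wpM2l//.
by rewrite (bigD1 i)//= lerDl sumr_ge0.
Qed.

Lemma entry_le_norm u i : `|u 0 i| <= `|u|.
Proof.
rewrite [leRHS]mx_normrE.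
exact: (le_bigmax _ (fun ij : 'I_1 * 'I_d => `|u ij.1 ij.2|) (0, i)).
Qed.

Lemma enorm_le_norm u : enorm u <= d%:R * `|u|.
Proof.
rewrite (le_trans (enorm_le_sum u))//.
rewrite (le_trans (ler_sum _ (fun i _ => entry_le_norm u i)))//.
by rewrite sumr_const card_ord mulr_natl.
Qed.

Lemma norm_le_enorm u : `|u| <= enorm u.
Proof.
rewrite [leLHS]mx_normrE; apply/bigmax_leP; split=> [|[i j] _]; first exact: enorm_ge0.
by rewrite /= ord1; exact: entry_le_enorm.
Qed.

Lemma near_enorm u e : 0 < e -> \forall v \near u, enorm (u - v) < e.
Proof.
move=> e0; have e1 : 0 < e / d.+1%:R by rewrite divr_gt0.
apply/nbhs_normP; exists (e / d.+1%:R) => // v /= uv.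
rewrite (le_lt_trans (enorm_le_norm _))//.
rewrite (@le_lt_trans _ _ (d.+1%:R * `|u - v|))// ?ler_wpM2r ?ler_nat//.
by rewrite -ltr_pdivlMl// mulrC.
Qed.

Lemma lipschitz_continuous (f : vec -> R) K :
  (forall u v, `|f u - f v| <= K * enorm (u - v)) -> continuous f.
Proof.
move=> fK u; apply/(@cvgrPdist_lt _ _ _ (nbhs u)) => e e0.
have K1 : 0 < `|K| + 1 by rewrite ltr_wpDl.
have e1 : 0 < e / (`|K| + 1) by rewrite divr_gt0.
apply: (@filterS _ _ (nbhs_filter u) _ _ _ (near_enorm u e1)) => v h.
rewrite (le_lt_trans (fK u v))//.
rewrite ltr_pdivlMr// mulrC in h; apply: le_lt_trans h.
rewrite ler_wpM2r ?enorm_ge0// (le_trans (ler_norm _))// lerDl//.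
Qed.

Lemma continuous_dot u : continuous (dot u).
Proof.
by apply: (@lipschitz_continuous _ (enorm u)) => v w; rewrite -dotBr abs_dot.
Qed.

Lemma continuous_enormB u : continuous (fun v => enorm (v - u)).
Proof.
apply: (@lipschitz_continuous _ 1) => v w; rewrite mul1r ler_norml.
have := enormD (v - w) (w - u); have := enormD (w - v) (v - u).
by rewrite !addrA !subrK (enorm_distC w v) => h1 h2; apply/andP; split; lra.
Qed.

Lemma closed_enorm_eq (r : R) : closed [set u : vec | enorm u = r].
Proof.
rewrite (_ : mkset _ = (fun u : vec => enorm (u - 0)) @^-1` [set r]).
  by apply: (continuous_closedP _).1; [exact: continuous_enormB|exact: closed_eq].
by apply/seteqP; split => u /=; rewrite subr0.
Qed.

Lemma closed_dot_ge u (r : R) : closed [set v | r <= dot u v].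
Proof.
by apply: ((continuous_closedP _).1 (@continuous_dot u) [set x | r <= x]); exact: closed_ge.
Qed.

Lemma closed_dot_le u (r : R) : closed [set v | dot u v <= r].
Proof.
by apply: ((continuous_closedP _).1 (@continuous_dot u) [set x | x <= r]); exact: closed_le.
Qed.

Lemma closed_dot_eq u (r : R) : closed [set v | dot u v = r].
Proof.
by apply: ((continuous_closedP _).1 (@continuous_dot u) [set x | x = r]); exact: closed_eq.
Qed.

Lemma closed_enormB_le u (r : R) : closed [set v | enorm (v - u) <= r].
Proof.
by apply: ((continuous_closedP _).1 (@continuous_enormB u) [set x | x <= r]); exact: closed_le.
Qed.

Lemma compact_enorm (A : set vec) M : closed A -> (forall u, A u -> enorm u <= M) ->
  compact A.
Proof.
move=> clA AM; apply: bounded_closed_compact => //.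
exists M; split; first exact: num_real.
by move=> y My u /AM uM /=; rewrite (le_trans (norm_le_enorm u))// (le_trans uM)// ltW.
Qed.

Lemma compact_enorm_bounded (A : set vec) : compact A ->
  exists2 M, 0 <= M & forall u, A u -> enorm u <= M.
Proof.
move=> cA; have [M [_ AM]] := compact_bounded cA.
exists (d%:R * (`|M| + 1)); first by rewrite mulr_ge0// addr_ge0.
move=> u Au; rewrite (le_trans (enorm_le_norm u))// ler_wpM2l//.
by apply: AM => //; rewrite (le_lt_trans (ler_norm _))// ltrDl.
Qed.

(** A cluster point of chosen witnesses lies in every [D m]: one direction per finite stage becomes
    one direction for all stages. *)
Lemma compact_nested (C : set vec) (D : nat -> set vec) : compact C ->
  (forall m, closed (D m)) -> (forall m n, (m <= n)%N -> D n `<=` D m) ->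
  (forall m, exists2 u, C u & D m u) -> exists2 u, C u & forall m, D m u.
Proof.
move=> cC clD ndD hD.
have [f [fC fD]] : exists f : nat -> vec, (forall m, C (f m)) /\ forall m, D m (f m).
  have h m : {u | C u /\ D m u}.
    by apply: cid; have [u Cu Du] := hD m; exists u.
  by exists (fun m => projT1 (h m)); split=> m; case: (h m) => u [].
have [|u [Cu cu]] := cC (f @ \oo) _ _.
  by exists 0%N => // n _ /=; exact: fC.
exists u => // m; apply: clD => B nB; apply: cu => //.
by exists m => // n /= mn; exact: (ndD _ _ mn).
Qed.

Lemma rat_approx u (e : R) : 0 < e ->
  exists q : 'rV[rat]_d, enorm (map_mx ratr q - u) < e.
Proof.
move=> e0; have e1 : 0 < e / d.+1%:R by rewrite divr_gt0.
have h i : {q : rat | `|ratr q - u 0 i| < e / d.+1%:R}.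
  apply: cid; have [|q] := @rat_in_itvoo R (u 0 i - e / d.+1%:R) (u 0 i + e / d.+1%:R).
    by rewrite ltrBlDr -addrA ltrDl addr_gt0.
  by rewrite in_itv/= => hq; exists q; rewrite ltr_distl.
exists (\row_i projT1 (h i)).
rewrite (le_lt_trans (enorm_le_sum _))//.
apply: (@le_lt_trans _ _ (\sum_(i < d) e / d.+1%:R)).
  by apply: ler_sum => i _; rewrite !mxE; case: (h i) => q /= /ltW.
rewrite sumr_const card_ord -[_ *+ d]mulr_natl mulrA ltr_pdivrMr// mulrC.
by rewrite ltr_pM2l// ltr_nat.
Qed.

End Euclid.

Section OpenPsum.
Context {R : realType} {d : nat}.
Local Notation vec := 'rV[R]_d.
Local Notation X := (seqT R d).

(** Such a set is open in the first [n] steps, hence a countable union of rational boxes. This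
    handles events with an uncountable quantifier, over directions or over points of a hull. *)
Lemma measurable_open_psum n (U : set X) :
  (forall x, U x -> exists2 e, 0 < e & forall y : X,
     (forall k, (k <= n)%N -> enorm (psum k y - psum k x) < e) -> U y) ->
  measurable U.
Proof.
move=> opU.
pose Box (q : {ffun 'I_n -> 'rV[rat]_d}) (m : nat) : set X :=
  [set y | forall i : 'I_n, enorm (map_mx ratr (q i) - y i) < m.+1%:R^-1].
pose sel (qm : {ffun 'I_n -> 'rV[rat]_d} * nat) : set X :=
  if `[< Box qm.1 qm.2 `<=` U >] then Box qm.1 qm.2 else set0.
have mBox q m : measurable (Box q m).
  rewrite (_ : Box q m = \bigcap_(i in [set: 'I_n])
     [set y : X | enorm (map_mx ratr (q i) - y i) < m.+1%:R^-1]); last first.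
    by apply/seteqP; split=> y h i; [move=> _; exact: h|exact: (h i I)].
  rewrite -[X in measurable X]setCK setC_bigcap; apply: measurableC.
  apply: countable_bigcupT_measurable; first exact: countableP.
  move=> i; apply: measurableC.
  apply: (@measurable_coord R d i [set v | enorm (map_mx ratr (q i) - v) < m.+1%:R^-1]).
  apply: sub_sigma_algebra; rewrite /=.
  rewrite (_ : mkset _ = (fun v : vec => enorm (v - map_mx ratr (q i))) @^-1`
     [set r | r < m.+1%:R^-1]); last first.
    by apply/seteqP; split=> v /=; rewrite enorm_distC.
  by apply: open_comp; [move=> v _; exact: continuous_enormB|exact: open_lt].
rewrite (_ : U = \bigcup_qm sel qm).
  apply: countable_bigcupT_measurable; first exact: countableP.
  by move=> qm; rewrite /sel; case: ifP.
apply/seteqP; split=> x; last first.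
  by move=> [qm _]; rewrite /sel; case: ifPn => // /asboolP; exact.
move=> Ux; have [e e0 eU] := opU x Ux.
(* Two points of a box differ by less than [2 / (m + 1)] in each step, hence by less than [e] in
   each partial sum up to [n]. *)
pose m := Num.truncn (2 * n.+1%:R / e).
have m0 : 0 < m.+1%:R^-1 :> R by rewrite invr_gt0.
have me : n.+1%:R * (2 * m.+1%:R^-1) < e.
  have : 2 * n.+1%:R / e < m.+1%:R by rewrite truncnS_gt.
  rewrite ltr_pdivrMr// => h.
  by rewrite mulrCA -/(_ / _) mulrA ltr_pdivrMr// [ltRHS]mulrC.
have h (i : 'I_n) := cid (rat_approx (x i) m0).
pose q := [ffun i : 'I_n => projT1 (h i)].
have xq : Box q m x by move=> i; rewrite /q ffunE; case: (h i).
exists (q, m) => //; rewrite /sel; case: ifPn => // /asboolPn; case => /= y yq.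
apply: eU => k kn; rewrite /psum -sumrB.
apply: le_lt_trans (enorm_sum _ _ _) _.
apply: (@le_lt_trans _ _ (\sum_(i < k) 2 * m.+1%:R^-1)); last first.
  rewrite sumr_const card_ord -[_ *+ k]mulr_natl; apply: le_lt_trans me.
  rewrite ler_pM2r ?mulr_gt0// ler_nat; exact: leqW.
apply: ler_sum => i _; have lti : (i < n)%N := leq_trans (ltn_ord i) kn.
have := xq (Ordinal lti); have := yq (Ordinal lti) => /=.
have := enormD (map_mx ratr (q (Ordinal lti)) - x i) (y i - map_mx ratr (q (Ordinal lti))).
rewrite (addrC _ (y i - _)) subrKA (enorm_distC (y i) (map_mx _ _)).
move=> /le_trans h1 h2 h3; apply: h1.
by rewrite mulrDl mul1r ltW// ltrD.
Qed.

End OpenPsum.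

(** * Directions in which the walk is bounded *)

Section Cone.
Context {R : realType} {d : nat}.
Local Notation vec := 'rV[R]_d.
Local Notation X := (seqT R d).

Lemma mulmx_tr_dot (u v : vec) : u *m v^T = (dot u v)%:M.
Proof.
apply/matrixP => i j; rewrite !ord1 !mxE eqxx mulr1n.
by apply: eq_bigr => k _; rewrite mxE.
Qed.

Lemma sub_kermx_tr (u v : vec) : (u <= kermx v^T)%MS = (dot u v == 0).
Proof.
rewrite sub_kermx mulmx_tr_dot; apply/eqP/eqP => [/matrixP/(_ 0 0)|->].
  by rewrite !mxE eqxx mulr1n.
by rewrite raddf0.
Qed.

Lemma closed_submx (G : 'M[R]_d) : closed [set u : vec | (u <= G)%MS].
Proof.
rewrite (_ : mkset _ = \bigcap_j [set u : vec | dot (col j (cokermx G))^T u = 0]).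
  by apply: closed_bigI => j _; exact: closed_dot_eq.
apply/seteqP; split=> u /=.
  rewrite submxE => /eqP /rowP uG j _ /=; have := uG j; rewrite !mxE => <-.
  by apply: eq_bigr => k _; rewrite !mxE mulrC.
move=> uG; rewrite submxE; apply/eqP/rowP => j; rewrite !mxE -[RHS](uG j I).
by apply: eq_bigr => k _; rewrite !mxE mulrC.
Qed.

Lemma finite_gap (a : nat -> R) N m : (forall k, (k <= m)%N -> a k < N) ->
  exists2 e, 0 < e & forall k, (k <= m)%N -> a k + e <= N.
Proof.
elim: m => [|m IH] aN.
  exists (N - a 0%N); first by rewrite subr_gt0 aN.
  by move=> k; rewrite leqn0 => /eqP ->; rewrite addrC subrK.
have [|e e0 ae] := IH; first by move=> k km; apply: aN; exact: leqW.
exists (Num.min e (N - a m.+1)); first by rewrite lt_min e0 subr_gt0 aN.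
move=> k; rewrite leq_eqVlt => /predU1P[->|km].
  by rewrite -lerBrDl ge_min lexx orbT.
by rewrite (le_trans _ (ae k km))// lerD2l ge_min lexx.
Qed.

(** The random cone of directions of boundedness need not be closed; it is observed only through the
    compact sets it meets. *)
Definition hits (C : set vec) (x : X) := exists2 u, C u & walk_bounded u 0 x.

Lemma walk_boundedP u (x : X) :
  walk_bounded u 0 x <-> exists C, forall n, dot u (psum n x) <= C.
Proof.
by split=> -[C xC]; exists C => n; have := xC n; rewrite mul0r subr0.
Qed.

Lemma walk_boundedZ u a (x : X) : 0 <= a -> walk_bounded u 0 x ->
  walk_bounded (a *: u) 0 x.
Proof.
move=> a0 /walk_boundedP[C xC]; apply/walk_boundedP; exists (a * C) => n.
by rewrite dotZl ler_wpM2l.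
Qed.

Lemma walk_boundedD u v (x : X) : walk_bounded u 0 x -> walk_bounded v 0 x ->
  walk_bounded (u + v) 0 x.
Proof.
move=> /walk_boundedP[C xC] /walk_boundedP[D xD]; apply/walk_boundedP.
by exists (C + D) => n; rewrite dotDl lerD.
Qed.

(** For a fixed bound, compactness replaces one direction for all times by one for each finite
    horizon. The strict bound makes the finite-horizon events open; the relaxed one makes the nested
    sets of directions closed. *)
Lemma measurable_hits C : compact C -> measurable [set x | hits C x].
Proof.
move=> cC.
rewrite (_ : mkset _ = \bigcup_N \bigcap_m
  [set x : X | exists2 u, C u & forall k, (k <= m)%N -> dot u (psum k x) < N%:R]).
  apply: bigcupT_measurable => N; apply: bigcapT_measurable => m.
  apply: (@measurable_open_psum _ _ m) => x [u Cu uN].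
  have [e e0 ue] := finite_gap uN.
  have u1 : 0 < enorm u + 1 by rewrite ltr_wpDl// enorm_ge0.
  exists (e / (enorm u + 1)); first by rewrite divr_gt0.
  move=> y xy; exists u => // k km; apply: lt_le_trans (ue k km).
  rewrite -ltrBlDl -dotBr (le_lt_trans (cauchy_schwarz _ _))//.
  have := xy k km; rewrite ltr_pdivlMr// => h; apply: le_lt_trans h.
  by rewrite mulrC ler_wpM2l ?enorm_ge0// lerDl.
apply/seteqP; split=> x /=.
  move=> [u Cu /walk_boundedP[M xM]]; exists (Num.truncn M).+1 => // m _ /=.
  by exists u => // k _; rewrite (le_lt_trans (xM k))// truncnS_gt.
move=> [N _ h].
have [||m|u Cu uN] := @compact_nested _ _ C
    (fun m => \bigcap_(k in [set k | (k <= m)%N]) [set u | dot (psum k x) u <= N%:R]) cC.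
- by move=> m; apply: closed_bigI => k _; exact: closed_dot_le.
- by move=> m n mn u h' k /= km; apply: h' => /=; exact: leq_trans mn.
- by have [u Cu uN] := h m I; exists u => // k /= km; rewrite dotC ltW// uN.
exists u => //; apply/walk_boundedP; exists N%:R => n.
by rewrite dotC; exact: (uN n n (leqnn n)).
Qed.

Variable Q : probability X R.
Hypothesis iidQ : iid Q.

Lemma hits01 C : compact C ->
  {ae Q, forall x, hits C x} \/ {ae Q, forall x, ~ hits C x}.
Proof.
move=> cC; have mC := measurable_hits cC.
have [|Q0|Q1] := hewitt_savage iidQ mC.
- move=> s fs; apply: aeW => x [u Cu ux]; exists u => //.
  exact: walk_bounded_finitary.
- by right; exact/ae_prob0.
- by left; exact/ae_prob1.
Qed.

(* If the cone of directions in which the walk is bounded above met [G], then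
   by induction it would avoid a dense set of hyperplanes of [G], hence be a
   ray; by the zero-one law for rational balls this ray would be deterministic. *)
Theorem bounded_directions_trivial (G : 'M[R]_d) :
  (forall u, (u <= G)%MS -> u != 0 -> {ae Q, forall x, ~ walk_bounded u 0 x}) ->
  {ae Q, forall x, forall u, (u <= G)%MS -> u != 0 -> ~ walk_bounded u 0 x}.
Proof.
have [r] := ubnP (\rank G); elim: r G => // r IH G rG hG.
pose Sph := [set u : vec | (u <= G)%MS] `&` [set u | enorm u = 1].
have clS : closed Sph by apply: closedI; [exact: closed_submx|exact: closed_enorm_eq].
have cS : compact Sph by apply: (compact_enorm clS) => u [_ ->].
have [S1|] := hits01 cS; last first.
  apply: filterS => x nx u uG u0 ux; apply: nx.
  exists ((enorm u)^-1 *: u); last by apply: walk_boundedZ; rewrite ?invr_ge0 ?enorm_ge0.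
  split=> /=; first exact: scalemx_sub.
  by rewrite enormZ normfV ger0_norm ?enorm_ge0// mulVf// enorm_eq0.
exfalso.
pose B (qm : 'rV[rat]_d * nat) :=
  Sph `&` [set v | enorm (v - map_mx ratr qm.1) <= qm.2.+1%:R^-1].
have cB qm : compact (B qm).
  have clB : closed (B qm) by apply: closedI => //; exact: closed_enormB_le.
  by apply: (compact_enorm clB) => u [[_ ->]].
pose z qm : Prop := {ae Q, forall x, hits (B qm) x}.
have balls : {ae Q, forall x, forall qm, hits (B qm) x <-> z qm}.
  apply: ae_forall_countable => qm; have [B1|B0] := hits01 (cB qm).
    by apply: filterS (B1) => x hx; split.
  apply: filterS (B0) => x nx; split=> [/nx//|B1]; exfalso.
  by have [y []] := ae_inhabited (filterI B0 B1).
have planes : {ae Q, forall x, forall q : 'rV[rat]_d,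
    forall u0, (u0 <= G)%MS -> dot u0 (map_mx ratr q) != 0 ->
    forall u, (u <= G)%MS -> dot u (map_mx ratr q) = 0 -> u != 0 ->
    ~ walk_bounded u 0 x}.
  apply: ae_forall_countable => q.
  have [[u0 [u0G u0q]]|none] :=
      pselect (exists u0, (u0 <= G)%MS /\ dot u0 (map_mx ratr q) != 0); last first.
    by apply: aeW => x u0 u0G u0q; exfalso; apply: none; exists u0.
  pose Gq := (G :&: kermx (map_mx ratr q)^T)%MS.
  have : {ae Q, forall x, forall u, (u <= Gq)%MS -> u != 0 -> ~ walk_bounded u 0 x}.
    apply: IH; last by move=> u; rewrite sub_capmx => /andP[uG _]; exact: hG.
    apply: (@leq_trans (\rank G)); last by rewrite -ltnS.
    apply: rank_ltmx.
    rewrite ltmxE capmxSl/=; apply/negP => GGq.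
    have := submx_trans u0G GGq; rewrite sub_capmx sub_kermx_tr (negbTE u0q).
    by rewrite andbF.
  apply: filterS => x hx _ _ _ u uG uq; apply: hx.
  by rewrite sub_capmx uG sub_kermx_tr uq eqxx.
(* The sample [x0] only supplies [u0]. At a second sample [x], the direction [u0] itself is excluded
   by [hG], but each rational ball containing [u0] is hit at [x0] and therefore at [x]. *)
have [x0 [[u0 [u0G u01] bu0] b0]] := ae_inhabited (filterI S1 balls).
have u0n : u0 != 0 by rewrite -enorm_gt0 u01.
have [x [nb [bx px]]] := ae_inhabited (filterI (hG _ u0G u0n) (filterI balls planes)).
have near_u0 e : 0 < e -> exists u, [/\ (u <= G)%MS, enorm u = 1,
    walk_bounded u 0 x & enorm (u - u0) < e].
  move=> e0; pose m := Num.truncn (2 / e).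
  have m0 : 0 < m.+1%:R^-1 :> R by rewrite invr_gt0.
  have me : 2 * m.+1%:R^-1 < e.
    have : 2 / e < m.+1%:R by rewrite truncnS_gt.
    by rewrite ltr_pdivrMr// mulrC ltr_pdivrMr.
  have [q qu0] := rat_approx u0 m0.
  have h0 : hits (B (q, m)) x0.
    exists u0; last exact: bu0.
    by split; last by apply/ltW; rewrite /= enorm_distC.
  have [u [[uG u1] uq] bu] := (bx (q, m)).2 ((b0 (q, m)).1 h0).
  exists u; split=> //.
  have -> : u - u0 = (u - map_mx ratr q) + (map_mx ratr q - u0) by rewrite subrKA.
  rewrite (le_lt_trans (enormD _ _))// (lt_trans _ me)// mulrDl mul1r.
  by rewrite ler_ltD.
have [|u1 [u1G u11 bu1 u1u0]] := near_u0 (2^-1); first by rewrite invr_gt0.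
have u10 : 0 < enorm (u1 - u0).
  by rewrite enorm_gt0 subr_eq0; apply/eqP => e; apply: nb; rewrite -e.
(* This radius forces [u2] to differ from [u1]; the earlier radius 1/2 makes their angle acute, so
   that the combination used at the end is nonzero. *)
have [|u2 [u2G u21 bu2 u2u0]] := near_u0 (enorm (u1 - u0)); first by [].
have d12 : 0 < dot u1 u2.
  have := enormD (u1 - u0) (u0 - u2); rewrite subrKA (enorm_distC u0) => h.
  have : enorm (u1 - u2) ^+ 2 < 1.
    by rewrite -[ltRHS](expr1n _ 2) ltr_pXn2r ?nnegrE ?enorm_ge0//; lra.
  rewrite enorm_sqr dotBl !dotBr -!enorm_sqr u11 u21 (dotC u2 u1); lra.
pose k := 1 - dot u1 u2.
have k0 : 0 < k.
  have : 0 < enorm (u1 - u2) ^+ 2.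
    rewrite exprn_gt0// enorm_gt0 subr_eq0; apply/eqP => e.
    by move: u2u0; rewrite -e ltxx.
  rewrite enorm_sqr dotBl !dotBr -!enorm_sqr u11 u21 (dotC u2 u1) /k; lra.
(* The vector [u1 - u2] has inner products [k] and [- k] with [u1] and [u2]. A rational vector
   within [k] of it still separates them, so a positive combination of both is orthogonal to it,
   against [planes]. *)
have [q qw] := rat_approx (u1 - u2) k0.
set v := map_mx ratr q in qw.
have v1 : 0 < dot u1 v.
  have := abs_dot u1 (v - (u1 - u2)); rewrite u11 mul1r ler_norml !dotBr -enorm_sqr u11.
  by rewrite expr1n -/k => /andP[h1 h2]; lra.
have v2 : dot u2 v < 0.
  have := abs_dot u2 (v - (u1 - u2)); rewrite u21 mul1r ler_norml !dotBr -enorm_sqr u21.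
  by rewrite expr1n (dotC u2 u1) => /andP[h1 h2]; move: qw; rewrite /k; lra.
apply: (px q u1 u1G (lt0r_neq0 v1) (- dot u2 v *: u1 + dot u1 v *: u2)).
- by rewrite addmx_sub// scalemx_sub.
- by rewrite dotDl !dotZl; ring.
- apply/eqP => e; have : dot u1 (- dot u2 v *: u1 + dot u1 v *: u2) = 0.
    by rewrite e dot0r.
  rewrite dotDr !dotZr -enorm_sqr u11 expr1n mulr1.
  have := mulr_gt0 v1 d12; lra.
- by apply: walk_boundedD; apply: walk_boundedZ => //; lra.
Qed.
End Cone.

(** * Convex hulls *)

Section Hull.
Context {R : realType} {d : nat}.
Local Notation vec := 'rV[R]_d.
Implicit Types (p : nat -> vec) (u v x z : vec).

Lemma hull_pts_point n p k : (k <= n)%N -> hull_pts n p (p k).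
Proof.
move=> kn; have kn1 : (k < n.+1)%N by [].
exists (fun i => ((i : nat) == k)%:R); split=> [i|]; first exact: ler0n.
have E (V : lmodType R) (f : 'I_n.+1 -> V) :
    \sum_(i < n.+1) ((i : nat) == k)%:R *: f i = f (Ordinal kn1).
  rewrite (bigD1 (Ordinal kn1))//= eqxx scale1r big1 ?addr0// => i ik.
  by rewrite (_ : (_ == k) = false) ?scale0r//; apply/negbTE; apply: contra ik.
split; last by rewrite E.
by have := E R^o (fun=> 1); under eq_bigr do rewrite [_ *: _]mulr1.
Qed.

Lemma hull_pts_convex n p : Defs.convex_set (hull_pts n p).
Proof.
move=> x y t [a [a0 [a1 ->]]] [b [b0 [b1 ->]]] /andP[t0 t1].
exists (fun k => t * a k + (1 - t) * b k); split=> [k|].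
  by rewrite addr_ge0// mulr_ge0// subr_ge0.
split; first by rewrite big_split/= -!mulr_sumr a1 b1 !mulr1 addrC subrK.
rewrite !scaler_sumr -big_split/=; apply: eq_bigr => k _.
by rewrite !scalerA -scalerDl.
Qed.

Lemma lipschitz_rV_continuous n (f : 'rV[R]_n -> vec) K :
  (forall u v : 'rV[R]_n, enorm (f u - f v) <= K * enorm (u - v)) -> continuous f.
Proof.
move=> fK u; apply/(@cvgrPdist_lt _ _ _ (nbhs u)) => e e0.
have K1 : 0 < `|K| + 1 by rewrite ltr_wpDl.
have e1 : 0 < e / (`|K| + 1) by rewrite divr_gt0.
apply: (@filterS _ _ (nbhs_filter u) _ _ _ (near_enorm u e1)) => v h.
rewrite (le_lt_trans (norm_le_enorm _))// (le_lt_trans (fK u v))//.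
rewrite ltr_pdivlMr// mulrC in h; apply: le_lt_trans h.
by rewrite ler_wpM2r ?enorm_ge0// (le_trans (ler_norm _))// lerDl.
Qed.

Lemma hull_pts_compact n p : compact (hull_pts n p).
Proof.
pose simplex := (\bigcap_k [set l : 'rV[R]_n.+1 | 0 <= dot (delta_mx 0 k) l]) `&`
  [set l : 'rV[R]_n.+1 | dot (const_mx 1) l = 1].
have dotd k (l : 'rV[R]_n.+1) : dot (delta_mx 0 k) l = l 0 k.
  rewrite /dot (bigD1 k)//= mxE !eqxx mul1r big1 ?addr0// => i ik.
  by rewrite mxE (negbTE ik) andbF mul0r.
have dot1 (l : 'rV[R]_n.+1) : dot (const_mx 1) l = \sum_k l 0 k.
  by apply: eq_bigr => k _; rewrite mxE mul1r.
have cls : closed simplex.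
  apply: closedI; last exact: closed_dot_eq.
  by apply: closed_bigI => k _; exact: closed_dot_ge.
have cs : compact simplex.
  apply: (compact_enorm cls (M := 1)) => l [l0 l1].
  rewrite (le_trans (enorm_le_sum _))// -l1 dot1; apply: ler_sum => k _.
  by have := l0 k I; rewrite /= dotd => h; rewrite ger0_norm.
pose f (l : 'rV[R]_n.+1) := \sum_k l 0 k *: p k.
have -> : hull_pts n p = f @` simplex.
  apply/seteqP; split=> x.
    move=> [a [a0 [a1 ->]]]; exists (\row_k a k).
      split=> [k _|] /=; first by rewrite dotd mxE.
      by rewrite dot1 -[RHS]a1; apply: eq_bigr => k _; rewrite mxE.
    by apply: eq_bigr => k _; rewrite mxE.
  move=> [l [l0 l1] <-]; exists (fun k => l 0 k); split=> [k|].
    by have := l0 k I; rewrite /= dotd.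
  by split=> //; rewrite -dot1.
apply: continuous_compact => //; apply: continuous_subspaceT.
apply: (@lipschitz_rV_continuous _ _ (\sum_(k < n.+1) enorm (p k))) => u v.
rewrite /f -sumrB (le_trans (enorm_sum _ _ _))// mulr_suml; apply: ler_sum => k _.
rewrite -scalerBl enormZ mulrC ler_wpM2l ?enorm_ge0//.
by have := entry_le_enorm (u - v) k; rewrite !mxE.
Qed.

Lemma hull_pts_C0d n p : p 0%N = 0 -> C0d (hull_pts n p).
Proof.
move=> p0; split; first exact: hull_pts_compact.
by split; [exact: hull_pts_convex|rewrite -p0; exact: hull_pts_point].
Qed.

Lemma dot_hull_le n p u c z : hull_pts n p z ->
  (forall k, (k <= n)%N -> dot u (p k) <= c) -> dot u z <= c.
Proof.
move=> [a [a0 [a1 ->]]] pc; rewrite dot_sumr -[leRHS]mul1r -a1 mulr_suml.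
by apply: ler_sum => k _; rewrite dotZr ler_wpM2l// pc// -ltnS.
Qed.

(* [u] points from the nearest point of the hull to [x]. *)
Lemma hull_separation n p x : ~ hull_pts n p x ->
  exists u, forall k, (k <= n)%N -> dot u (p k) < dot u x.
Proof.
move=> nx.
have [|y /set_mem Hy ymin] := @compact_EVT_min vec R (fun y => enorm (y - x)) (hull_pts n p)
  _ (@hull_pts_compact n p) (continuous_subspaceT (@continuous_enormB _ _ x)).
  by exists (p 0%N); exact: hull_pts_point.
pose u := x - y.
have u0 : u != 0.
  by rewrite subr_eq0; apply/eqP => xy; apply: nx; rewrite xy.
have uu : 0 < dot u u by rewrite -enorm_sqr exprn_gt0// enorm_gt0.
exists u => k kn; apply: (@le_lt_trans _ _ (dot u y)); last first.
  by rewrite -subr_gt0 -dotBr.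
rewrite leNgt; apply/negP; rewrite -subr_gt0 -dotBr.
set w := p k - y => c0.
have w0 : w != 0 by apply/eqP => w0; rewrite w0 dot0r ltxx in c0.
have ww : 0 < dot w w by rewrite -enorm_sqr exprn_gt0// enorm_gt0.
(* The minimiser of [enorm (t *: w - u)], capped at 1 to stay on the segment from [y] to [p k]. *)
pose t := Num.min 1 (dot u w / dot w w).
have t0 : 0 < t by rewrite lt_min ltr01 divr_gt0.
have t1 : t <= 1 by rewrite ge_min lexx.
have tw : t * dot w w <= dot u w by rewrite -ler_pdivlMr// ge_min lexx orbT.
have Hz : hull_pts n p (t *: p k + (1 - t) *: y).
  by apply: hull_pts_convex => //; [exact: hull_pts_point|rewrite ltW].
have zE : t *: p k + (1 - t) *: y - x = t *: w - u.
  by rewrite scalerBl scale1r scalerBr /u opprB; apply/rowP => j; rewrite !mxE; ring.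
have expand : dot (t *: w - u) (t *: w - u) =
    t * (t * dot w w) - 2 * (t * dot u w) + dot u u.
  by move: (u) (w) => a b; rewrite dotBl !dotBr !dotZl !dotZr (dotC b a); ring.
have := ymin _ (mem_set Hz); rewrite zE (enorm_distC y x) -/u.
rewrite -(@ler_pXn2r _ 2)// ?nnegrE ?enorm_ge0// !enorm_sqr.
rewrite expand => h.
have : 2 * (t * dot u w) <= t * (t * dot w w) by lra.
rewrite mulrCA ler_pM2l//; lra.
Qed.

(** The deterministic core of the argument. The last hypothesis lets any separating direction be
    replaced by one in [V], where the unboundedness hypothesis is available. *)
Lemma hull_diff_bounded p p' k mu (V : 'M[R]_d) :
  p 0%N = 0 -> p' 0%N = 0 -> (forall j, (k <= j)%N -> p j = p' j) ->
  (forall delta, 0 < delta -> exists C, forall n,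
     enorm (p n - n%:R *: mu) <= delta * n%:R + C) ->
  (forall u, (u <= V)%MS -> u != 0 -> 0 <= dot u mu ->
     forall N, exists n, N < dot u (p n)) ->
  (forall u, exists2 u', (u' <= V)%MS & forall n,
     dot u (p n) = dot u' (p n) /\ dot u (p' n) = dot u' (p' n)) ->
  exists r N, forall n, (N <= n)%N -> hull_pts n p `\` hull_pts n p' `<=` eball 0 r.
Proof.
move=> p0 p'0 pp' lin osc proj.
pose Bd := \sum_(j < k) enorm (p j).
have Bdp j : (j < k)%N -> enorm (p j) <= Bd.
  move=> jk; rewrite /Bd (bigD1 (Ordinal jk))//= lerDl.
  by apply: sumr_ge0 => i _; exact: enorm_ge0.
pose Sph := [set u : vec | (u <= V)%MS] `&` [set u | enorm u = 1].
have clS : closed Sph by apply: closedI; [exact: closed_submx|exact: closed_enorm_eq].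
have cS : compact Sph by apply: (compact_enorm clS) => u [_ ->].
(* A direction in every [D m] would have nonnegative drift and a bounded path. By compactness some
   [m] already excludes all unit directions of [V]; it fixes both the gap [delta] and the horizon
   [k + m]. *)
pose D m := [set u | - m.+1%:R^-1 <= dot mu u] `&`
  \bigcap_(j in [set j | (k <= j <= k + m)%N]) [set u | dot (p j) u <= Bd].
have [m mD] : exists m, forall u, Sph u -> ~ D m u.
  apply: contrapT => /forallNP hD.
  have [||m|u [uV u1] uD] := @compact_nested _ _ Sph D cS.
  - move=> m; apply: closedI; first exact: closed_dot_ge.
    by apply: closed_bigI => j _; exact: closed_dot_le.
  - move=> m n mn u [h1 h2]; split=> /=.
      apply: le_trans h1; rewrite lerN2 lef_pV2 ?posrE// ler_nat//.
    by move=> j /= /andP[kj jm]; apply: h2; rewrite /= kj (leq_trans jm)// leq_add2l.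
  - apply: contrapT => h; apply: (hD m) => u Su Du; apply: h; by exists u.
  have u0 : u != 0 by rewrite -enorm_gt0 u1.
  have um : 0 <= dot u mu.
    rewrite leNgt; apply/negP => neg.
    have [+ _] := uD (Num.truncn (- dot u mu)^-1).
    rewrite /= (dotC mu u) leNgt => /negP; apply.
    by rewrite ltrNr invf_plt ?posrE ?oppr_gt0// truncnS_gt.
  have [n] := osc u uV u0 um Bd; apply/negP; rewrite -leNgt.
  have [nk|kn] := ltnP n k.
    by rewrite (le_trans (cauchy_schwarz _ _))// u1 mul1r Bdp.
  have [_ h] := uD (n - k)%N; rewrite dotC; apply: h => /=.
  by apply/andP; split=> //; rewrite subnKC.
pose delta : R := m.+1%:R^-1.
have delta0 : 0 < delta by rewrite invr_gt0.
have d2 : 0 < delta / 2 by rewrite divr_gt0.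
have [C hC] := lin _ d2.
have C0 : 0 <= C.
  by have := hC 0%N; rewrite p0 scale0r subr0 enorm0 mulr0 add0r.
(* This bounds [z = s *: mu + q], where [s] is the mean index of the convex combination,
   [s <= C / (delta / 2)] and [enorm q <= delta / 2 * s + C]. *)
exists ((enorm mu + delta / 2) * (C / (delta / 2)) + C), (k + m)%N => n kmn z [Hz nHz].
have [u0 hu0] := hull_separation nHz.
have [u' u'V hu'] := proj u0.
have dotz : dot u0 z = dot u' z.
  case: Hz => a [_ [_ ->]]; rewrite !dot_sumr; apply: eq_bigr => j _.
  by rewrite !dotZr (hu' j).1.
have {hu0} hu j : (j <= n)%N -> dot u' (p' j) < dot u' z.
  by move=> /hu0; rewrite (hu' j).2 dotz.
have uz : 0 < dot u' z by have := hu 0%N isT; rewrite p'0 dot0r.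
have u'0 : 0 < enorm u'.
  by rewrite enorm_gt0; apply/eqP => e; rewrite e dot0l ltxx in uz.
pose w := (enorm u')^-1 *: u'.
have Sw : Sph w.
  split=> /=; first exact: scalemx_sub.
  by rewrite enormZ normfV ger0_norm ?enorm_ge0// mulVf// gt_eqF.
have hw j : (j <= n)%N -> dot w (p' j) < dot w z.
  by move=> jn; rewrite !dotZl ltr_pM2l ?invr_gt0// hu.
have wz : 0 < dot w z by rewrite dotZl mulr_gt0// invr_gt0.
have [j jn wj] : exists2 j, (j <= n)%N & dot w z <= dot w (p j).
  apply: contrapT => h.
  have [|e e0 he] := @finite_gap R (fun j => dot w (p j)) (dot w z) n.
    by move=> j jn; rewrite ltNge; apply/negP => h'; apply: h; exists j.
  have : dot w z <= dot w z - e.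
    by apply: (dot_hull_le Hz) => j jn; rewrite lerBrDr he.
  lra.
have jk : (j < k)%N.
  rewrite ltnNge; apply/negP => kj; have := hw j jn.
  by rewrite -(pp' j kj) ltNge wj.
have wzB : dot w z <= Bd.
  by rewrite (le_trans wj)// (le_trans (cauchy_schwarz _ _))// Sw.2 mul1r Bdp.
have wmu : dot w mu < - delta.
  rewrite ltNge; apply/negP => h; apply: (mD w Sw); split; first by rewrite /= dotC.
  move=> i /= /andP[ki ikm]; rewrite dotC (pp' i ki) (le_trans _ wzB)// ltW// hw//.
  exact: leq_trans kmn.
case: Hz => a [a0 [a1 zE']].
pose s := \sum_(i < n.+1) a i * (i : nat)%:R.
have s0 : 0 <= s by apply: sumr_ge0 => i _; rewrite mulr_ge0.
pose q := \sum_(i < n.+1) a i *: (p i - (i : nat)%:R *: mu).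
have zs : z = s *: mu + q.
  rewrite zE' /q /s scaler_suml -big_split/=; apply: eq_bigr => i _.
  by rewrite scalerBr scalerA addrC subrK.
have qC : enorm q <= delta / 2 * s + C.
  have CE : C = \sum_(i < n.+1) a i * C by rewrite -mulr_suml a1 mul1r.
  rewrite (le_trans (enorm_sum _ _ _))// /s mulr_sumr [X in _ + X]CE -big_split/=.
  by apply: ler_sum => i _; rewrite enormZ ger0_norm// mulrCA -mulrDr ler_wpM2l.
(* In [0 < dot w z] the drift contributes at most [- delta * s] and the remainder at most
   [delta / 2 * s + C]. *)
have sC : s <= C / (delta / 2).
  rewrite ler_pdivlMr//.
  have := cauchy_schwarz w q; rewrite Sw.2 mul1r => wq.
  have : 0 < s * dot w mu + dot w q by rewrite -dotZr -dotDr -zs.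
  have : s * dot w mu <= s * - delta by rewrite ler_wpM2l// ltW.
  rewrite (_ : s * - delta = - 2 * (delta / 2 * s)); last by field.
  rewrite (mulrC s (delta / 2)); move: qC; move: (delta / 2 * s) => t; lra.
rewrite /eball /= subr0 zs (le_trans (enormD _ _))// enormZ ger0_norm//.
rewrite mulrDl -addrA lerD//; first by rewrite mulrC ler_wpM2l ?enorm_ge0.
by rewrite (le_trans qC)// lerD2r ler_wpM2l// ltW.
Qed.

End Hull.

(** * Measurability of functionals of the hull *)

Section HullMeasurable.
Context {R : realType} {d : nat}.
Local Notation vec := 'rV[R]_d.
Local Notation X := (seqT R d).

Definition walk_hull (n : nat) (x : nat -> vec) : set vec :=
  hull_pts n (fun k => psum k x).

Lemma psum0 (x : nat -> vec) : psum 0 x = 0.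
Proof. by rewrite /psum big_ord0. Qed.

Lemma walk_hull_C0d n x : C0d (walk_hull n x).
Proof. by apply: hull_pts_C0d; exact: psum0. Qed.

Definition hausdorff_radius (A B : set vec) (r : R) :=
  0 <= r /\ (forall a, A a -> exists2 b, B b & enorm (a - b) <= r) /\
  (forall b, B b -> exists2 a, A a & enorm (a - b) <= r).

(** Both sets contain 0, so the sum of their radii works. Existence is needed to extract an actual
    radius from a bound on the infimum [rhoH]. *)
Lemma hausdorff_radius_exists A B : C0d A -> C0d B ->
  exists r, hausdorff_radius A B r.
Proof.
move=> [cA [_ A0]] [cB [_ B0]].
have [M M0 AM] := compact_enorm_bounded cA.
have [N N0 BN] := compact_enorm_bounded cB.
exists (M + N); split; first exact: addr_ge0.
split=> [a Aa|b Bb].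
  by exists 0 => //; rewrite subr0 (le_trans (AM _ Aa))// lerDl.
by exists 0 => //; rewrite sub0r enormN (le_trans (BN _ Bb))// lerDr.
Qed.

Lemma hull_pts_close n (p q : nat -> vec) e z :
  (forall k, (k <= n)%N -> enorm (p k - q k) <= e) ->
  hull_pts n p z -> exists2 z', hull_pts n q z' & enorm (z - z') <= e.
Proof.
move=> pq [a [a0 [a1 ->]]]; exists (\sum_(k < n.+1) a k *: q k); first by exists a.
rewrite -sumrB (le_trans (enorm_sum _ _ _))// -[leRHS]mul1r -[X in _ <= X * _]a1.
rewrite mulr_suml; apply: ler_sum => k _.
by rewrite -scalerBr enormZ ger0_norm// ler_wpM2l// pq// -ltnS.
Qed.

(** Moving each vertex by at most [e] moves the hull by at most [e], so the event is open in the
    partial sums. *)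
Lemma measurable_rhoH_walk_hull n D r : C0d D ->
  measurable [set x : X | rhoH D (walk_hull n x) < r].
Proof.
move=> CD; apply: (@measurable_open_psum _ _ n) => x /= xr.
have [r1 [r10 [h1 h2]] r1r] : exists2 r1, hausdorff_radius D (walk_hull n x) r1 & r1 < r.
  by apply: inf_lt xr; exact: hausdorff_radius_exists (walk_hull_C0d n x).
have e0 : 0 < (r - r1) / 2 by rewrite divr_gt0// subr_gt0.
exists ((r - r1) / 2) => // y xy.
apply: (@le_lt_trans _ _ (r1 + (r - r1) / 2)); last by lra.
apply: ge_inf; first by exists 0 => t [].
split; first by rewrite addr_ge0// ltW.
split=> [a /h1[b Hb ab]|b Hb].
  have [|b' Hb' bb'] := hull_pts_close _ Hb (q := fun k => psum k y) (e := (r - r1) / 2).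
    by move=> k kn; apply/ltW; rewrite enorm_distC; exact: xy.
  exists b' => //; rewrite -[a - b'](subrKA b).
   by rewrite (le_trans (enormD _ _))// lerD.
have [|b' Hb' bb'] := hull_pts_close _ Hb (q := fun k => psum k x) (e := (r - r1) / 2).
  by move=> k kn; apply/ltW; exact: xy.
have [a Da ab'] := h2 _ Hb'.
exists a => //; rewrite -[a - b](subrKA b').
by rewrite (le_trans (enormD _ _))// lerD// enorm_distC.
Qed.

Lemma measurable_walk_hull n (S : set (set vec)) : hausdorff_borel2 S ->
  measurable [set x : X | S (walk_hull n x)].
Proof.
pose K := [set S : set (set vec) | measurable [set x : X | S (walk_hull n x)]].
suff: @hausdorff_borel2 R d `<=` K by apply.
apply: smallest_sub; first split.
- by rewrite /K /=; exact: measurable0.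
(* Complements are relative to [C0d], which contains every [walk_hull]. *)
- move=> A KA; rewrite /K /= (_ : mkset _ = ~` [set x : X | A (walk_hull n x)]).
    exact: measurableC.
  by apply/seteqP; split=> x /= => [[]//|nA]; split=> //; exact: walk_hull_C0d.
- move=> A KA; rewrite /K /= (_ : mkset _ = \bigcup_k [set x : X | A k (walk_hull n x)]).
    by apply: bigcupT_measurable => k; exact: KA.
  by apply/seteqP; split=> x /= [k]; exists k.
move=> _ [D [r [CD ->]]]; rewrite /K /=.
rewrite (_ : mkset _ = [set x : X | rhoH D (walk_hull n x) < r]).
  exact: measurable_rhoH_walk_hull.
by apply/seteqP; split=> x /= => [[]//|h]; split=> //; exact: walk_hull_C0d.
Qed.

Lemma measurable_functional_walk_hull (F : set vec -> R) n : functional_on_C0d F ->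
  measurable_fun setT (fun x : X => F (walk_hull n x)).
Proof.
move=> [_ mF]; apply: (measurability _ (RGenOInfty.measurableE R)).
move=> _ [_ [a ->] <-]; rewrite setTI.
rewrite (_ : _ @^-1` _ = ~` [set x : X | [set C | C0d C /\ F C <= a] (walk_hull n x)]).
  by apply: measurableC; exact: (measurable_walk_hull n (mF a)).
apply/seteqP; split=> x /=; rewrite in_itv/= andbT.
  by move=> h [_]; rewrite leNgt h.
by move=> h; rewrite ltNge; apply/negP => h'; apply: h; split=> //; exact: walk_hull_C0d.
Qed.

End HullMeasurable.

Section Limsup.
Context {R : realType}.
Implicit Types f g : nat -> R.

Lemma limn_esup_le f (K : \bar R) : (\forall n \near \oo, ((f n)%:E <= K)%E) ->
  (limn_esup (EFin \o f) <= K)%E.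
Proof.
move=> fK; apply: ge_ereal_inf.
exists (ereal_sup ((EFin \o f) @` [set n | ((f n)%:E <= K)%E])).
  by exists [set n | ((f n)%:E <= K)%E].
by apply: ge_ereal_sup => _ [n /= nK <-].
Qed.

Lemma limn_esup_lt f (K : \bar R) : (limn_esup (EFin \o f) < K)%E ->
  \forall n \near \oo, ((f n)%:E < K)%E.
Proof.
move=> /ereal_inf_lt[_ [A oA <-] AK]; apply: filterS oA => n An.
by apply: le_lt_trans AK; apply: ereal_sup_ubound; exists n.
Qed.

Lemma limn_esup_asymp_le f g : (forall n, 0 <= g n) ->
  (forall eps, 0 < eps < 1 -> \forall n \near \oo, f n <= (1 + eps) * g n) ->
  (limn_esup (EFin \o f) <= limn_esup (EFin \o g))%E.
Proof.
move=> g0 fg.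
have L0 : (0 <= limn_esup (EFin \o g))%E.
  apply: limf_esup_ge0; last by move=> n; rewrite lee_fin.
  by move=> [n _ /(_ n (leqnn n))].
apply/lee_addgt0Pr => e e0.
move: L0; case EL : (limn_esup (EFin \o g)) => [L| |]//; last by move=> _; rewrite addye// leey.
rewrite lee_fin => L0.
have e2 : 0 < e / 2 by rewrite divr_gt0.
(* Chosen so that [(1 + eps) * (L + e / 2) <= L + e]; the cap 1/2 keeps it below 1. *)
pose eps := Num.min (1 / 2) (e / 2 / (L + e / 2)).
have Le : 0 < L + e / 2 by rewrite ltr_wpDl.
have eps0 : 0 < eps by rewrite lt_min !divr_gt0.
have eps1 : eps < 1 by rewrite gt_min; apply/orP; left; lra.
have epsL : eps * (L + e / 2) <= e / 2 by rewrite -ler_pdivlMr// ge_min lexx orbT.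
have gL : \forall n \near \oo, ((g n)%:E < (L + e / 2)%:E)%E.
  by apply: limn_esup_lt; rewrite EL lte_fin ltrDl.
apply: limn_esup_le; near=> n.
rewrite lee_fin (@le_trans _ _ ((1 + eps) * g n))//.
  by near: n; apply: fg; rewrite eps0.
apply: (@le_trans _ _ ((1 + eps) * (L + e / 2))).
  rewrite ler_wpM2l//; first by rewrite addr_ge0// ltW.
  rewrite ltW// -lte_fin; near: n; exact: gL.
by rewrite mulrDl mul1r; lra.
Unshelve. all: by end_near. Qed.

End Limsup.

(** * Invariance of the upper limit *)

Section LinearAlgebra.
Context {R : realType} {d : nat}.
Local Notation vec := 'rV[R]_d.

(** Such a [u] is a combination of the rows of [A] and orthogonal to all of them, hence to
    itself. *)
Lemma kermx_tr_cap (A : 'M[R]_d) (u : vec) :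
  (u <= A)%MS -> (u <= kermx A^T)%MS -> u = 0.
Proof.
move=> /submxP[w ->]; rewrite sub_kermx => /eqP h.
have : (w *m A) *m (w *m A)^T = 0 by rewrite trmx_mul mulmxA h mul0mx.
rewrite mulmx_tr_dot => /matrixP/(_ 0 0); rewrite !mxE eqxx mulr1n.
by rewrite -enorm_sqr => /eqP; rewrite sqrf_eq0 enorm_eq0 => /eqP.
Qed.

Lemma orthogonal_decomposition (A : 'M[R]_d) (u : vec) :
  exists2 a, (a <= A)%MS & (u - a <= kermx A^T)%MS.
Proof.
have cap0 : (A :&: kermx A^T)%MS = 0.
  apply/eqP; rewrite -submx0; apply/rV_subP => v; rewrite sub_capmx => /andP[vA vK].
  by rewrite (kermx_tr_cap vA vK) sub0mx.
have full : row_full (A + kermx A^T)%MS.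
  rewrite /row_full mxrank_disjoint_sum// mxrank_ker mxrank_tr subnKC//.
  exact: rank_leq_row.
have : (u <= A + kermx A^T)%MS by exact: submx_full.
move=> /sub_addsmxP[[w1 w2]/= ->]; exists (w1 *m A); first exact: submxMl.
by rewrite addrAC subrr add0r submxMl.
Qed.

(** A matrix of largest rank with row space inside [N] exhausts it, since a further vector of [N]
    would raise the rank. *)
Lemma submx_of_subspace (N : vec -> Prop) : N 0 ->
  (forall a u v, N u -> N v -> N (a *: u + v)) ->
  exists A : 'M[R]_d, forall u, (u <= A)%MS <-> N u.
Proof.
move=> N0 Nlin.
pose P r := `[< exists2 A : 'M[R]_d, \rank A = r & forall u, (u <= A)%MS -> N u >].
have exP : exists r, P r.
  exists 0%N; apply/asboolP; exists 0; first exact: mxrank0.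
  by move=> u; rewrite submx0 => /eqP ->.
have bP r : P r -> (r <= d)%N by move=> /asboolP[A <- _]; exact: rank_leq_row.
case: (ex_maxnP exP bP) => r /asboolP[A rA AN] rmax.
exists A => u; split=> [/AN//|Nu]; apply: contrapT => /negP uA.
have AuN v : (v <= A + u)%MS -> N v.
  move=> /sub_addsmxP[[w1 w2]/= ->]; rewrite addrC [w2]mx11_scalar mul_scalar_mx.
  by apply: Nlin => //; apply: AN; exact: submxMl.
have : (\rank (A + u)%MS <= r)%N.
  by apply: rmax; apply/asboolP; exists (A + u)%MS.
rewrite leqNgt -rA => /negP; apply; apply: rank_ltmx.
by rewrite ltmxE addsmxSl addsmx_sub submx_refl.
Qed.

End LinearAlgebra.

Section Goodness.
Context {R : realType} {d : nat}.
Local Notation vec := 'rV[R]_d.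
Local Notation X := (seqT R d).
Variable Q : probability X R.
Hypothesis iidQ : iid Q.
Variable mu : vec.
Hypothesis int_dot : forall u, Q.-integrable setT (fun x => (dot u (x 0%N))%:E).
Hypothesis mean_dot : forall u, (\int[Q]_x (dot u (x 0%N))%:E = (dot u mu)%:E)%E.

Lemma ae_linear_speed : {ae Q, forall x : X, forall delta, 0 < delta ->
  exists C, forall n, enorm (psum n x - n%:R *: mu) <= delta * n%:R + C}.
Proof.
pose e j : vec := delta_mx 0 j.
have doteE j v : dot (e j) v = v 0 j.
  rewrite /dot (bigD1 j)//= mxE !eqxx mul1r big1 ?addr0// => i ij.
  by rewrite mxE (negbTE ij) andbF mul0r.
have : {ae Q, forall x : X, forall jm : 'I_d * nat,
    walk_bounded (e jm.1) (dot (e jm.1) mu + jm.2.+1%:R^-1) x /\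
    walk_bounded (- e jm.1) (dot (- e jm.1) mu + jm.2.+1%:R^-1) x}.
  apply: ae_forall_countable => -[j m] /=.
  have drift u : {ae Q, forall x : X, walk_bounded u (dot u mu + m.+1%:R^-1) x}.
    by apply: (walk_bounded_drift iidQ int_dot mean_dot); rewrite ltrDl.
  exact: filterS2 (fun x => @conj _ _) (drift _) (drift _).
apply: filterS => x h delta delta0.
pose m := Num.truncn (d%:R / delta).
have dm : d%:R * m.+1%:R^-1 <= delta.
  rewrite ler_pdivrMr// mulrC -ler_pdivrMr//.
  by rewrite ltW// truncnS_gt.
have hj j : exists C, forall n, `|(psum n x - n%:R *: mu) 0 j| <= m.+1%:R^-1 * n%:R + C.
  have [[C1 h1] [C2 h2]] := h (j, m).
  exists (Num.max C1 C2) => n; rewrite -doteE dotBr dotZr ler_norml.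
  have := h1 n; have := h2 n; rewrite /= !dotNl => k1 k2.
  have M1 : C1 <= Num.max C1 C2 by rewrite le_max lexx.
  have M2 : C2 <= Num.max C1 C2 by rewrite le_max lexx orbT.
  move: (m.+1%:R^-1) k1 k2 => t k1 k2.
  by apply/andP; split; lra.
pose C j := projT1 (cid (hj j)).
exists (\sum_j C j) => n; rewrite (le_trans (enorm_le_sum _))//.
apply: (@le_trans _ _ (\sum_(j < d) (m.+1%:R^-1 * n%:R + C j))).
  by apply: ler_sum => j _; rewrite /C; case: (cid (hj j)).
rewrite big_split/= lerD2r sumr_const card_ord -[_ *+ d]mulr_natl mulrA.
by rewrite ler_wpM2r.
Qed.

Lemma null_directions : exists A : 'M[R]_d, forall u : vec,
  (u <= A)%MS <-> {ae Q, forall x : X, dot u (x 0%N) = 0}.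
Proof.
apply: (@submx_of_subspace _ _ (fun u => {ae Q, forall x : X, dot u (x 0%N) = 0})).
  by apply: aeW => x; rewrite dot0l.
move=> a u v /= hu hv; apply: filterS2 hu hv => x u0 v0.
by rewrite dotDl dotZl u0 v0 mulr0 addr0.
Qed.

(** The path properties that [hull_diff_bounded] consumes. The second would fail in a direction
    orthogonal to all steps, hence the restriction to [V], taken below as the complement of the null
    directions. *)
Definition spreading (V : 'M[R]_d) (x : X) :=
  [/\ forall delta, 0 < delta -> exists C, forall n,
        enorm (psum n x - n%:R *: mu) <= delta * n%:R + C,
      forall u, (u <= V)%MS -> u != 0 -> 0 <= dot u mu ->
        forall N, exists n, N < dot u (psum n x) &
      forall u, exists2 u', (u' <= V)%MS & forall n, dot u (x n) = dot u' (x n)].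

Lemma ae_spreading : exists V, {ae Q, forall x : X, spreading V x}.
Proof.
have [A nullA] := null_directions.
exists (kermx A^T).
have steps : {ae Q, forall x : X, forall u, (u <= A)%MS -> forall n, dot u (x n) = 0}.
  have : {ae Q, forall x : X, forall ni : nat * 'I_d, dot (row ni.2 A) (x ni.1) = 0}.
    apply: ae_forall_countable => -[n i] /=.
    have := (nullA (row i A)).1 (row_sub _ _).
    move=> /(ae_reidx iidQ (@addnI n)); apply: filterS => x.
    by rewrite /reidx addn0.
  apply: filterS => x h u /submxP[w ->] n.
  rewrite mulmx_sum_row dotC dot_sumr big1// => i _.
  by rewrite dotZr dotC (h (n, i)) mulr0.
have flat : {ae Q, forall x : X, forall u, (u <= kermx A^T :&: kermx mu^T)%MS -> u != 0 ->
    ~ walk_bounded u 0 x}.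
  apply: bounded_directions_trivial => // u; rewrite sub_capmx => /andP[uK um] u0.
  rewrite sub_kermx_tr in um; move/eqP: um => um.
  apply: (driftless_unbounded iidQ int_dot mean_dot um); apply/negP => /eqP Q0.
  have uA : (u <= A)%MS.
    have mN : measurable [set x : X | dot u (x 0%N) != 0].
      rewrite (_ : mkset _ = ~` [set x : X | dot u (x 0%N) = 0]).
        apply: measurableC; rewrite -[X in measurable X]setTI.
        exact: (@measurable_dot_coord _ _ u 0%N measurableT [set 0]).
      by apply/seteqP; split=> x /=; move/eqP.
    apply/nullA; have := (ae_prob0 Q mN).2 Q0; apply: filterS => x /= /negP.
    by rewrite negbK => /eqP.
  by move: u0; rewrite (kermx_tr_cap uA uK) eqxx.
apply: filterS3 ae_linear_speed steps flat => x lin st fl; split=> //.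
- move=> u uV u0; rewrite le_eqVlt => /predU1P[um|um] N.
    have := fl u; rewrite sub_capmx uV sub_kermx_tr -um eqxx => /(_ isT u0) nb.
    apply: contrapT => /forallNP h; apply: nb; apply/walk_boundedP; exists N => n.
    by rewrite leNgt; apply/negP; exact: h.
  have eu : 0 < enorm u by rewrite enorm_gt0.
  (* With this [delta] the deviation consumes at most half of the drift, up to a constant. *)
  pose delta := dot u mu / (2 * enorm u).
  have delta0 : 0 < delta by rewrite divr_gt0// mulr_gt0.
  have [C hC] := lin _ delta0.
  pose n := (Num.truncn ((N + enorm u * C) / (dot u mu / 2))).+1.
  exists n.
  have nN : N + enorm u * C < n%:R * (dot u mu / 2).
    by rewrite -ltr_pdivrMr ?divr_gt0// truncnS_gt.
  have := abs_dot u (psum n x - n%:R *: mu).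
  rewrite ler_norml dotBr dotZr => /andP[h1 _].
  have h2 : enorm u * enorm (psum n x - n%:R *: mu) <= enorm u * (delta * n%:R + C).
    by rewrite ler_pM2l.
  have : enorm u * (delta * n%:R + C) = n%:R * (dot u mu / 2) + enorm u * C.
    by rewrite /delta; field; rewrite gt_eqF.
  move: (n%:R) nN h1 h2 => t; lra.
- move=> u; have [a aA uaV] := orthogonal_decomposition A u.
  by exists (u - a) => // n; rewrite dotBl (st a aA) subr0.
Qed.

Variable F : set vec -> R.
Hypothesis fF : functional_on_C0d F.
Hypothesis mF : macroscopic F.

(** One half of the symmetric difference; the other comes from exchanging [x] and [reidx s x], as
    [s] is an involution. *)
Lemma spreading_symdiff_bounded V s (x : X) : finitary s ->
  spreading V x -> spreading V (reidx s x) ->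
  exists r N, forall n, (N <= n)%N ->
    walk_hull n x `\` walk_hull n (reidx s x) `<=` eball 0 r.
Proof.
move=> [sK [k sk]] [lin osc pr] _.
apply: (@hull_diff_bounded _ _ _ _ k mu V) => //.
- exact: psum0.
- exact: psum0.
- by move=> j kj; rewrite (psum_finitary _ sK sk kj).
- move=> u; have [u' u'V h] := pr u; exists u' => // n.
  by rewrite !dot_psum; split; apply: eq_bigr => i _; rewrite /reidx h.
Qed.

Lemma macroscopic_ratio (eps : R) r v C1 C2 : 0 < eps < 1 -> C0d C1 -> C0d C2 ->
  (forall C1 C2, C0d C1 -> C0d C2 -> symdiff C1 C2 `<=` eball 0 r ->
      v <= F C1 -> `|F C1 / F C2 - 1| <= eps) ->
  symdiff C1 C2 `<=` eball 0 r -> v <= F C1 -> F C1 <= (1 + eps) * F C2.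
Proof.
move=> /andP[e0 e1] c1 c2 mac sd vF; have := mac _ _ c1 c2 sd vF.
(* Division by zero gives 0, so a vanishing [F C2] would make the error equal to 1, above [eps]. *)
have [->|F0] := eqVneq (F C2) 0.
  by rewrite invr0 mulr0 sub0r normrN1 leNgt e1.
have Fp : 0 < F C2 by rewrite lt_neqAle eq_sym F0 fF.1.
rewrite ler_norml => /andP[_]; rewrite lerBlDr ler_pdivrMr//.
by rewrite addrC.
Qed.

Variable b : nat -> R.
Hypothesis b0 : forall n, 0 < b n.
Hypothesis Foo : {ae Q, forall x : X, forall M, \forall n \near \oo, M <= F (walk_hull n x)}.

Let lsup (x : X) := limn_esup (fun n => (F (walk_hull n x) / b n)%:E).

Lemma ratio_ge0 n (x : X) : 0 <= F (walk_hull n x) / b n.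
Proof.
by rewrite divr_ge0//; [exact: (fF.1 _ (walk_hull_C0d n x))|exact: ltW].
Qed.

Lemma lsup_le (x y : X) r N :
  (forall n, (N <= n)%N -> symdiff (walk_hull n x) (walk_hull n y) `<=` eball 0 r) ->
  0 <= r -> (forall M, \forall n \near \oo, M <= F (walk_hull n x)) ->
  (lsup x <= lsup y)%E.
Proof.
move=> sd r0 xoo.
apply: (@limn_esup_asymp_le _ (fun n => F (walk_hull n x) / b n)
  (fun n => F (walk_hull n y) / b n)); first by move=> n; exact: ratio_ge0.
move=> eps e01; have [v [_ mac]] := mF e01 r0.
near=> n; rewrite mulrA ler_wpM2r//; first by rewrite invr_ge0 ltW.
apply: (macroscopic_ratio e01 (walk_hull_C0d n x) (walk_hull_C0d n y) mac).
  by apply: sd; near: n; exact: nbhs_infty_ge.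
by near: n; exact: xoo.
Unshelve. all: by end_near. Qed.

Lemma ae_lsup_constant : exists2 c, (0 <= c)%E & {ae Q, forall x : X, lsup x = c}.
Proof.
have [V sprV] := ae_spreading.
have [c lc] : exists c, {ae Q, forall x : X, lsup x = c}.
  apply: ae_constant => //.
  - move=> q; rewrite -[X in measurable X]setTI; apply: emeasurable_fun_o_infty => //.
    apply: measurable_fun_limn_esup => n; apply/measurable_EFinP.
    by apply: measurable_funM => //; exact: measurable_functional_walk_hull.
  - move=> s fs; have injs := inv_inj fs.1.
    pose good (x : X) := spreading V x /\
      forall M, \forall n \near \oo, M <= F (walk_hull n x).
    have aeg : {ae Q, forall x, good x} by apply: filterS2 sprV Foo => x ? ?; split.
    apply: filterS2 aeg (ae_reidx iidQ injs aeg) => x [sx Fx] [ssx Fsx].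
    have [r1 [N1 h1]] := spreading_symdiff_bounded fs sx ssx.
    have fx : reidx s (reidx s x) = x by apply/funext => i; rewrite /reidx fs.1.
    have [|r2 [N2 h2]] := spreading_symdiff_bounded fs ssx; first by rewrite fx.
    rewrite fx in h2.
    pose r := Num.max 0 (Num.max r1 r2).
    have r0 : 0 <= r by rewrite le_max lexx.
    have sub1 : eball 0 r1 `<=` (eball 0 r : set vec).
      by move=> z /= /le_trans; apply; rewrite !le_max lexx orbT.
    have sub2 : eball 0 r2 `<=` (eball 0 r : set vec).
      by move=> z /= /le_trans; apply; rewrite !le_max lexx !orbT.
    have sd n : (maxn N1 N2 <= n)%N ->
        symdiff (walk_hull n x) (walk_hull n (reidx s x)) `<=` eball 0 r.
      rewrite geq_max => /andP[n1 n2] z [/(h1 n n1)/sub1//|/(h2 n n2)/sub2//].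
    apply/eqP; rewrite eq_le; apply/andP; split.
      apply: (lsup_le (r := r) (N := maxn N1 N2)) => // n /sd; apply: subset_trans.
      by move=> z []; [right|left].
    exact: (lsup_le (r := r) (N := maxn N1 N2)).
exists c => //; have [x <-] := ae_inhabited lc.
apply: limf_esup_ge0; last by move=> n; rewrite lee_fin; exact: ratio_ge0.
by move=> [n _ /(_ n (leqnn n))].
Qed.

End Goodness.

Theorem theorem4p4 (R : realType) (dsp : measure_display) (T : measurableType dsp)
  (P : probability T R) (d : nat) (Z : nat -> T -> 'rV[R]_d)
  (F : set 'rV[R]_d -> R) :
  (2 <= d)%N ->
  (forall n, random_vector (Z n)) ->
  mutually_independent P Z ->
  identically_distributed P Z ->
  P.-integrable setT (fun w => (enorm (Z 0%N w))%:E) ->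
  mean_vec P (Z 0%N) != 0 ->
  functional_on_C0d F ->
  macroscopic F ->
  let S := fun (n : nat) (w : T) => \sum_(i < n) Z i w in
  let H := fun (n : nat) (w : T) => hull_pts n (fun k => S k w) in
  {ae P, forall w, (fun n => F (H n w)) @ \oo --> +oo} ->
  forall b : nat -> R, (forall n, 0 < b n) ->
  exists2 c : \bar R, (0 <= c)%E &
    {ae P, forall w, limn_esup (fun n => (F (H n w) / b n)%:E) = c}.
Proof.
move=> _ mZ indZ idZ intZ _ fF mF S H Foo b b0.
pose Zs (w : T) : seqT R d := fun n => Z n w.
have mZs : measurable_fun setT Zs by apply: measurable_into_seqT => i; exact: mZ.
pose Zm : {mfun T >-> seqT R d} :=
  MeasurableFun.Pack (MeasurableFun.Class (isMeasurableFun.Build _ _ _ _ _ mZs)).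
pose Q : probability (seqT R d) R := distribution P Zm.
have QE (A : set (seqT R d)) : Q A = P (Zs @^-1` A) by [].
have aeQP (A : seqT R d -> Prop) : {ae Q, forall x, A x} -> {ae P, forall w, A (Zs w)}.
  move=> [N [mN N0 sN]]; exists (Zs @^-1` N); split=> //.
    by rewrite -[_ @^-1` _]setTI; exact: (mZs).
  by move=> w /= nA; exact: sN.
have iidQ : iid Q.
  split=> [s B us mB|n B mB]; first exact: (indZ s B us mB).
  exact: (idZ n B mB).
have intP u : P.-integrable setT (fun w => (dot u (Z 0%N w))%:E).
  have mu : measurable_fun setT (fun w => dot u (Zs w 0%N)).
    by apply: (measurableT_comp (measurable_dot_coord u 0%N)).
  have intE := integrableZl measurableT (enorm u) intZ.
  apply: (le_integrable measurableT _ _ intE); first exact/measurable_EFinP.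
  move=> w _; rewrite -EFinM lee_fin.
  by rewrite (le_trans (abs_dot _ _))// ler_norm.
have mdot u : measurable_fun setT (fun x : seqT R d => (dot u (x 0%N))%:E).
  by apply/measurable_EFinP; exact: measurable_dot_coord.
have int_dot u : Q.-integrable setT (fun x => (dot u (x 0%N))%:E).
  exact: (@integrable_pushforward _ _ _ _ _ _ mZs P setT _ (mdot u) (intP u)).
pose mu := mean_vec P (Z 0%N).
have mean_dot u : (\int[Q]_x (dot u (x 0%N))%:E = (dot u mu)%:E)%E.
  transitivity (\int[P]_w (dot u (Z 0%N w))%:E)%E.
    exact: (@integral_pushforward _ _ _ _ _ _ mZs P setT _ (mdot u) (intP u)).
  have entry w j : Z 0%N w 0 j = dot (delta_mx 0 j) (Z 0%N w).
    rewrite /dot (bigD1 j)//= mxE !eqxx mul1r big1 ?addr0// => i ij.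
    by rewrite mxE (negbTE ij) andbF mul0r.
  have intj j : P.-integrable setT (fun w => (Z 0%N w 0 j)%:E).
    rewrite (_ : (fun _ => _) = (fun w => (dot (delta_mx 0 j) (Z 0%N w))%:E)) //.
    by apply/funext => w; rewrite entry.
  transitivity (\int[P]_w \sum_j (u 0 j)%:E * (Z 0%N w 0 j)%:E)%E.
    by apply: eq_integral => w _; rewrite -sumEFin.
  rewrite integral_sum//; last by move=> j; apply: integrableZl.
  rewrite -sumEFin; apply: eq_bigr => j _; rewrite integralZl// mxE EFinM fineK//.
  exact: integrable_fin_num.
have FooQ : {ae Q, forall x : seqT R d,
    forall M, \forall n \near \oo, M <= F (walk_hull n x)}.
  (* Almost sure statements pull back from [Q] to [P], but the converse passage is made through a
     measurable event; hence the countable quantifiers. *)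
  pose E : set (seqT R d) :=
    \bigcap_m \bigcup_N \bigcap_k [set x | m%:R < F (walk_hull (N + k)%N x)].
  have mE : measurable E.
    apply: bigcapT_measurable => m; apply: bigcupT_measurable => N.
    apply: bigcapT_measurable => k; apply: measurable_superlevel.
    exact: measurable_functional_walk_hull.
  have QE1 : {ae Q, forall x, E x}.
    apply/ae_prob1 => //; apply/(ae_prob1 P) => //.
      by rewrite -[_ @^-1` _]setTI; exact: (mZs).
    apply: filterS Foo => w /cvgryPgt Fw m _.
    have [N _ hN] := Fw m%:R; exists N => // k _.
    by apply: hN; rewrite /= leq_addr.
  apply: filterS QE1 => x Ex M.
  have [N _ hN] := Ex (Num.truncn M).+1 I.
  exists N => // n /= Nn; have := hN (n - N)%N I; rewrite /= subnKC// => /ltW.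
  by apply: le_trans; rewrite ltW// truncnS_gt.
have [c c0 lc] := ae_lsup_constant iidQ int_dot mean_dot fF mF b0 FooQ.
by exists c => //; exact: (aeQP _ lc).
Qed.
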